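(* For all integers $n\ge1$ and $k\ge 1$, the reduced Čech cohomology with integer coefficients of the Higson compactification of hyperbolic space vanishes in even degrees: $\bar H^{2k}(\overline{\mathbb{H}^n};\mathbb{Z})=0$.
   Context: The (standard) Higson compactification $\overline X=X\cup\nu X$ of a proper metric space $X$ is the compactification whose algebra of continuous functions is the algebra of bounded continuous slowly oscillating functions $f:X\to\mathbb{C}$, where $f$ is slowly oscillating if for every $r>0$, $\operatorname{diam} f(B_r(x))\to0$ as $x\to\infty$. $\mathbb{H}^n$ is $n$-dimensional real hyperbolic space; $\bar H^*$ denotes reduced Čech cohomology. *)

(* Defs.v *)
From HB Require Import structures.
From mathcomp Require Import all_boot all_order all_algebra.
From mathcomp Require Import all_classical all_reals all_analysis.
Set Implicit Arguments. Unset Strict Implicit. Unset Printing Implicit Defensive.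
Import Order.TTheory GRing.Theory Num.Theory.
Import numFieldNormedType.Exports.
Local Open Scope classical_set_scope.
Local Open Scope ring_scope.

Definition minkowski (R : realType) (n : nat) (x y : 'rV[R]_n.+1) : R :=
  - (x ord0 ord0 * y ord0 ord0)
  + \sum_(i < n.+1 | i != ord0) x ord0 i * y ord0 i.

Definition on_hyperboloid (R : realType) (n : nat) (x : 'rV[R]_n.+1) : Prop :=
  minkowski x x = -1 /\ 0 < x ord0 ord0.

Definition hyp_space (R : realType) (n : nat) : Type :=
  {x : 'rV[R]_n.+1 | on_hyperboloid x}.

Definition arcosh (R : realType) (t : R) : R := ln (t + Num.sqrt (t ^+ 2 - 1)).

Definition hyp_dist (R : realType) (n : nat) (x y : hyp_space R n) : R :=
  arcosh (- minkowski (proj1_sig x) (proj1_sig y)).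

Definition hyp_origin_vec (R : realType) (n : nat) : 'rV[R]_n.+1 :=
  \row_(i < n.+1) (if i == ord0 then 1 else 0).

Definition higson_function (R : realType) (X : Type) (d : X -> X -> R) (o : X)
    (f : X -> R) : Prop :=
  (exists M : R, forall x, `|f x| <= M) /\
  (forall x (e : R), 0 < e -> exists2 delta : R, 0 < delta &
      forall y, d x y < delta -> `|f x - f y| < e) /\
  (forall r : R, 0 < r -> forall e : R, 0 < e -> exists Rad : R,
      forall x, Rad < d o x ->
        forall y z, d x y < r -> d x z < r -> `|f y - f z| <= e).

Definition higson_index (R : realType) (X : Type) (d : X -> X -> R) (o : X) :=
  {f : X -> R | higson_function d o f}.

Definition higson_eval (R : realType) (X : Type) (d : X -> X -> R) (o : X)
    (x : X) : {ptws (higson_index d o) -> R} :=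
  fun f => proj1_sig f x.

Definition higson_compactification (R : realType) (X : Type)
    (d : X -> X -> R) (o : X) : set {ptws (higson_index d o) -> R} :=
  closure (range (@higson_eval R X d o)).

(* an open cover of A, indexed by I; U i is (the trace on A of) an open set *)
Definition open_cover (T : topologicalType) (A : set T) (I : Type)
    (U : I -> set T) : Prop :=
  (forall i, open (U i)) /\ A `<=` \bigcup_i U i.

Definition nerve_simplex (T : topologicalType) (A : set T) (I : Type)
    (U : I -> set T) (q : nat) (s : 'I_q.+1 -> I) : Prop :=
  exists2 x, A x & forall k, U (s k) x.

Definition cech_delta (I : Type) (q : nat) (c : ('I_q.+1 -> I) -> int)
    (s : 'I_q.+2 -> I) : int :=
  \sum_(j < q.+2) (-1) ^+ j * c (fun k => s (lift j k)).

Definition cech_cocycle (T : topologicalType) (A : set T) (I : Type)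
    (U : I -> set T) (q : nat) (c : ('I_q.+1 -> I) -> int) : Prop :=
  forall s : 'I_q.+2 -> I, nerve_simplex A U s -> cech_delta c s = 0.

Definition cech_coboundary (T : topologicalType) (A : set T) (I : Type)
    (U : I -> set T) (q : nat) (c : ('I_q.+2 -> I) -> int) : Prop :=
  exists b : ('I_q.+1 -> I) -> int,
    forall s : 'I_q.+2 -> I, nerve_simplex A U s -> c s = cech_delta b s.

Definition refines_via (T : topologicalType) (A : set T) (I J : Type)
    (U : I -> set T) (V : J -> set T) (lam : J -> I) : Prop :=
  forall j, A `&` V j `<=` U (lam j).

(* H^{q+1}(A; Z) = 0  (Cech; degree q+1 cochains live on (q+2)-tuples), i.e. every cocycle becomes a coboundary after  *)
(* passing to a suitable refinement (vanishing of the direct limit).         *)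
Definition cech_H_vanishes (T : topologicalType) (A : set T) (q : nat) : Prop :=
  forall (I : Type) (U : I -> set T), open_cover A U ->
  forall c : ('I_q.+2 -> I) -> int, cech_cocycle A U c ->
  exists (J : Type) (V : J -> set T) (lam : J -> I),
    [/\ open_cover A V, refines_via A U V lam &
        cech_coboundary A V (fun s => c (fun k => lam (s k)))].

Lemma hyp_origin_ok (R : realType) (n : nat) : on_hyperboloid (hyp_origin_vec R n).
Proof.
rewrite /on_hyperboloid /minkowski /hyp_origin_vec !mxE eqxx; split; last exact: ltr01.
rewrite big1 ?addr0 ?mulr1 // => i /negbTE hi; by rewrite !mxE hi mul0r.
Qed.

Definition hyp_origin (R : realType) (n : nat) : hyp_space R n :=
  exist _ (hyp_origin_vec R n) (hyp_origin_ok R n).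

Arguments higson_eval {R X} d o x.
Arguments higson_compactification {R X} d o.

(* Main.v *)
Require Import Defs.
From mathcomp Require Import all_boot all_order all_algebra.
From mathcomp Require Import all_classical all_reals all_analysis.
From mathcomp Require Import ring lra zify.
Import numFieldNormedType.Exports.
Import Order.TTheory GRing.Theory Num.Theory.
Set Implicit Arguments. Unset Strict Implicit. Unset Printing Implicit Defensive.

(** A Cech cocycle of the Higson compactification is a bounded integer cocycle on
    a net of the hyperbolic space whose mesh grows to infinity.  In polar
    coordinates take spheres of radius r_k with r_(k+1) - r_k -> oo and, on the
    k-th sphere, the directions close to the lattice Z^n / N_k, where N_k is a
    little smaller than e^(r_(k-1)).  Going down from level k+1 to level k by
    rounding a direction contracts distances by N_k / N_(k+1) -> 0, so if the
    rounding is randomly shifted, then all the vertices of a small simplex are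
    almost surely rounded to the same vertex.  A primitive b_(k+1) of the cocycle
    c on level k+1 is obtained by pulling back b_k; replacing a fixed rounding by
    the average of all of them changes the pullback by a coboundary, and the
    coboundary of the integer part of the averaging homotopy keeps it integral up
    to a bounded error.  The average is at most |b_k| / 2 plus the contribution of
    the constant simplices x^q, and b_k (x^q) = (d b_k) (x^(q+1)) = c (x^(q+1))
    since q is even.  So the b_k are uniformly bounded.  As the net has bounded
    multiplicity, its vertices can be given finitely many labels that determine
    the values of b; the unions of the cells with a given label are supported by
    slowly oscillating functions, hence extend to a finite cover of the
    compactification on which the cocycle is a coboundary. *)

(** * Cochains on lists *)

Section ListCochains.
Local Open Scope ring_scope.

(** The simplicial coboundary in a recursive form that needs no sign indices: the first face minus
    the coboundary of the cochain with its head frozen. [list_deltaE] recovers the alternating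
    sum. *)
Fixpoint list_delta (A : Type) (c : seq A -> int) (s : seq A) : int :=
  if s is x :: s' then c s' - list_delta (fun t => c (x :: t)) s' else 0.

(** The classical prism operator: the alternating sum of the values of [c] on
    [f x_0, ..., f x_i, g x_i, ..., g x_m]. *)
Fixpoint prism (A B : Type) (f g : A -> B) (c : seq B -> int) (s : seq A) : int :=
  if s is x :: s' then
    c [:: f x, g x & map g s'] - prism f g (fun t => c (f x :: t)) s'
  else 0.

Lemma eq_list_delta (A : Type) (c c' : seq A -> int) s :
  c =1 c' -> list_delta c s = list_delta c' s.
Proof.
by elim: s c c' => //= x s IH c c' e; rewrite e (IH _ (fun t => c' (x :: t))).
Qed.

Lemma eq_prism_fun (A : eqType) (B : Type) (f f' g g' : A -> B) c s :
  {in s, f =1 f'} -> {in s, g =1 g'} -> prism f g c s = prism f' g' c s.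
Proof.
elim: s c => //= x s IH c ef eg.
rewrite (ef x) ?mem_head // (eg x) ?mem_head //.
have es y : y \in s -> y \in x :: s by move=> ys; rewrite inE ys orbT.
rewrite IH; first 1 last.
- by move=> y ys; apply/ef/es.
- by move=> y ys; apply/eg/es.
congr (c [:: _, _ & _] - _).
by apply/eq_in_map => y ys; apply/eg/es.
Qed.

Lemma list_deltaD (A : Type) (c c' : seq A -> int) s :
  list_delta (fun t => c t + c' t) s = list_delta c s + list_delta c' s.
Proof.
elim: s c c' => [|x s IH] c c' /=; first by rewrite addr0.
by rewrite (IH (fun t => c (x :: t)) (fun t => c' (x :: t))); ring.
Qed.

Lemma list_deltaN (A : Type) (c : seq A -> int) s :
  list_delta (fun t => - c t) s = - list_delta c s.
Proof.
elim: s c => [|x s IH] c /=; first by rewrite oppr0.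
by rewrite (IH (fun t => c (x :: t))); ring.
Qed.

Lemma list_deltaMl (A : Type) (m : int) (c : seq A -> int) s :
  list_delta (fun t => m * c t) s = m * list_delta c s.
Proof.
elim: s c => [|x s IH] c /=; first by rewrite mulr0.
by rewrite (IH (fun t => c (x :: t))); ring.
Qed.

Lemma list_delta_sum (A : Type) (W : finType) (c : W -> seq A -> int) s :
  list_delta (fun t => \sum_w c w t) s = \sum_w list_delta (c w) s.
Proof.
elim: s c => [|x s IH] c /=; first by rewrite big1.
by rewrite (IH (fun w t => c w (x :: t))) sumrB.
Qed.

Lemma list_delta_map (A B : Type) (f : A -> B) (c : seq B -> int) s :
  list_delta (fun t => c (map f t)) s = list_delta c (map f s).
Proof.
elim: s c => //= x s IH c.
by rewrite (IH (fun t => c (f x :: t))).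
Qed.

Lemma prismB (A B : Type) (f g : A -> B) (c c' : seq B -> int) s :
  prism f g (fun t => c t - c' t) s = prism f g c s - prism f g c' s.
Proof.
elim: s c c' => [|x s IH] c c' /=; first by rewrite subr0.
by rewrite (IH (fun t => c (f x :: t)) (fun t => c' (f x :: t))); ring.
Qed.

Lemma list_delta_delta (A : Type) (c : seq A -> int) s :
  list_delta (list_delta c) s = 0.
Proof.
elim: s c => //= x s IH c.
rewrite (list_deltaD c (fun t => - list_delta (fun u => c (x :: u)) t)).
by rewrite list_deltaN IH; ring.
Qed.

(** By induction on the list: the terms starting with [f x, g x] and the two copies of
    [prism f g c s] cancel. What remains is [c (g x :: map g s) - c (f x :: map g s)] and the
    induction hypothesis for the cochain with head [f x]. *)
Lemma prism_homotopy (A B : Type) (f g : A -> B) (c : seq B -> int) s :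
  list_delta (prism f g c) s + prism f g (list_delta c) s
    = c (map g s) - c (map f s).
Proof.
elim: s c => [|x s IH] c /=; first by ring.
rewrite (list_deltaD (fun t => c [:: f x, g x & map g t])
           (fun t => - prism f g (fun u => c (f x :: u)) t)) list_deltaN.
rewrite (list_delta_map g (fun t => c [:: f x, g x & t])).
rewrite (prismB _ _ c (list_delta (fun t => c (f x :: t)))).
have := IH (fun t => c (f x :: t)).
lra.
Qed.

Lemma eq_in_list_delta (A : eqType) (c c' : seq A -> int) s :
  (forall t, {subset t <= s} -> size s = (size t).+1 -> c t = c' t) ->
  list_delta c s = list_delta c' s.
Proof.
elim: s c c' => //= x s IH c c' e.
rewrite e //; last by move=> y ys; rewrite inE ys orbT.
congr (_ - _); apply: IH => t ts et; apply: e => /=; last by rewrite et.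
by move=> y; rewrite !inE => /orP[->//|/ts ->]; rewrite orbT.
Qed.

Lemma eq_in_prism (A B : eqType) (Q : B -> Prop) (f g : A -> B) c c' s :
  (forall t, (forall y, y \in t -> Q y) -> size t = (size s).+1 -> c t = c' t) ->
  (forall x, x \in s -> Q (f x) /\ Q (g x)) ->
  prism f g c s = prism f g c' s.
Proof.
elim: s c c' => //= x s IH c c' e h.
have [qf qg] := h x (mem_head _ _).
have hs y : y \in s -> Q (f y) /\ Q (g y) by move=> ys; apply: h; rewrite inE ys orbT.
rewrite e /= ?size_map //; last first.
  move=> y; rewrite !inE => /orP[/eqP->//|/orP[/eqP->//|/mapP[z zs ->]]].
  by case: (hs z zs).
congr (_ - _); apply: IH => // t tQ st; apply: e => /=; last by rewrite st.
by move=> y; rewrite inE => /orP[/eqP->|/tQ].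
Qed.

Lemma normr_list_delta (A : eqType) (c : seq A -> int) (C : int) s :
  (forall t, {subset t <= s} -> size s = (size t).+1 -> `|c t| <= C) ->
  `|list_delta c s| <= (size s)%:Z * C.
Proof.
elim: s c => [|x s IH] c e; first by rewrite /= normr0 mul0r.
rewrite [list_delta _ _]/= [size _]/=.
have h1 : `|c s| <= C by apply: e => // y ys; rewrite inE ys orbT.
have h2 : `|list_delta (fun t => c (x :: t)) s| <= (size s)%:Z * C.
  apply: IH => t ts et; apply: e => /=; last by rewrite et.
  by move=> y; rewrite !inE => /orP[->//|/ts ->]; rewrite orbT.
rewrite (le_trans (ler_normB _ _)) //.
by rewrite -addn1 PoszD mulrDl mul1r addrC lerD.
Qed.

Lemma normr_prism (A B : eqType) (Q : B -> Prop) (f g : A -> B) c (C : int) s :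
  (forall t, (forall y, y \in t -> Q y) -> size t = (size s).+1 -> `|c t| <= C) ->
  (forall x, x \in s -> Q (f x) /\ Q (g x)) ->
  `|prism f g c s| <= (size s)%:Z * C.
Proof.
elim: s c => [|x s IH] c e h; first by rewrite /= normr0 mul0r.
rewrite [prism _ _ _ _]/= [size _]/=.
have [qf qg] := h x (mem_head _ _).
have hs y : y \in s -> Q (f y) /\ Q (g y) by move=> ys; apply: h; rewrite inE ys orbT.
have h1 : `|c [:: f x, g x & map g s]| <= C.
  apply: e => /=; rewrite ?size_map // => y.
  rewrite !inE => /orP[/eqP->//|/orP[/eqP->//|/mapP[z zs ->]]].
  by case: (hs z zs).
have h2 : `|prism f g (fun t => c (f x :: t)) s| <= (size s)%:Z * C.
  apply: IH => // t tQ st; apply: e => /=; last by rewrite st.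
  by move=> y; rewrite inE => /orP[/eqP->|/tQ].
rewrite (le_trans (ler_normB _ _)) //.
by rewrite -addn1 PoszD mulrDl mul1r addrC lerD.
Qed.

(** All faces of a constant simplex coincide, so the signs cancel in pairs or leave one term. This
    is how the parity of the degree enters the proof. *)
Lemma list_delta_nseq (A : Type) (c : seq A -> int) m x :
  list_delta c (nseq m.+1 x) = if odd m then 0 else c (nseq m x).
Proof.
elim: m c => [|m IH] c; first by rewrite /= subr0.
have -> : list_delta c (nseq m.+2 x) =
    c (nseq m.+1 x) - list_delta (fun t => c (x :: t)) (nseq m.+1 x) by [].
by rewrite IH /=; case: (odd m) => /=; rewrite ?subr0 ?subrr.
Qed.

End ListCochains.

(** * Bounded primitives on a tower of levels *)

Section Tower.
Local Open Scope ring_scope.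
Variables (Z : eqType) (U : Type) (near : nat -> U -> Z -> Prop).
Variables (W : nat -> finType) (w0 : forall k, W k) (f : forall k, W k -> Z -> Z).
Variable z : Z.
Hypothesis near_f : forall k u (w : W k) a, near k.+1 u a -> near k u (f w a).
Hypothesis near_z : forall u, near 0 u z.

(** Simplices of the net span at most two consecutive levels, and all their vertices are near one
    common [u]. *)
Definition near_pair j u (p : nat * Z) := (p.1 = j \/ p.1 = j.+1) /\ near p.1 u p.2.

Variables (q : nat) (c : seq (nat * Z) -> int) (C : int).
Hypothesis normr_c : forall s, `|c s| <= C.
Hypothesis delta_c : forall j u s, (forall p, p \in s -> near_pair j u p) ->
  list_delta c s = 0.
Hypothesis q_even : ~~ odd q.
Hypothesis q_gt0 : (0 < q)%N.
Variable k0 : nat.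
(** At least half of the shifts collapse a simplex to one vertex; the factor 2 makes the recursion
    for the bounds contracting. *)
Hypothesis scatter_le : forall k u s, (k0 <= k)%N ->
  (forall a, a \in s -> near k.+1 u a) -> size s = q ->
  (2 * #|[set w : W k | ~~ constant (map (f w) s)]| <= #|W k|)%N.

Let shift (k : nat) (p : nat * Z) := if p.1 == k then p.2 else f (w0 k) p.2.

Let avg k (beta : seq Z -> int) (s : seq Z) : int :=
  ((\sum_(w : W k) prism (f (w0 k)) (f w) beta s) %/ (#|W k|)%:Z)%Z.

(* The averaging term moves the pullback of [beta] along the fixed map
   [f (w0 k)] to the mean of its pullbacks along all the [f w], up to the
   coboundary of a fractional part. *)
Let mixed k (beta : seq Z -> int) (s : seq (nat * Z)) : int :=
  beta (map (shift k) s)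
  - prism id id c (map (pair k) (map (shift k) s))
  + prism (fun p => (k, shift k p)) id c s
  + list_delta (fun t => if all (fun p => p.1 == k.+1) t
                         then avg k beta (map snd t) else 0) s.

(** The recursion starts with a cone: its apex [z] is near every [u] at level 0. *)
Fixpoint level k : seq Z -> int :=
  if k is k'.+1 then fun s => mixed k' (level k') (map (pair k) s)
  else fun s => c ((0%N, z) :: map (pair 0%N) s).

Let W_gt0 k : (0 < #|W k|)%N.
Proof. by apply/card_gt0P; exists (w0 k). Qed.

Let near_shift k u p : near_pair k u p -> near k u (shift k p).
Proof.
case: p => j a [/= hj na]; rewrite /shift /=; case: eqP => [<-//|nj].
by apply: near_f; case: hj => // <-.
Qed.

(** The prism from the projected vertices to the original ones carries the pullback of [c] to [c].
    The prism of the identity with itself is closed, so it does not affect the coboundary; it is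
    subtracted for the sake of [mixed_pure]. *)
Let delta_mixed k u beta s :
  (forall t, (forall a, a \in t -> near k u a) ->
     list_delta beta t = c (map (pair k) t)) ->
  (forall p, p \in s -> near_pair k u p) ->
  list_delta (mixed k beta) s = c s.
Proof.
move=> hb hs; rewrite /mixed !list_deltaD list_deltaN list_delta_delta addr0.
have ns a : a \in map (shift k) s -> near k u a.
  by case/mapP=> p ps ->; apply/near_shift/hs.
have ns' p : p \in map (pair k) (map (shift k) s) -> near_pair k u p.
  by case/mapP=> a /ns na ->; split; [left|].
rewrite (list_delta_map (shift k) beta) hb //.
have e1 := prism_homotopy id id c (map (pair k) (map (shift k) s)).
have e2 := prism_homotopy (fun p => (k, shift k p)) id c s.
rewrite (eq_in_prism (Q := near_pair k u) (c' := fun=> 0)) in e1; first last.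
- by move=> p /ns' np; split.
- by move=> t nt _; apply: (delta_c nt).
rewrite (eq_in_prism (Q := near_pair k u) (c' := fun=> 0)) in e2; first last.
- move=> p ps; split; last exact: hs.
  by split; [left|apply/near_shift/hs].
- by move=> t nt _; apply: (delta_c nt).
have p0 (A B : Type) (g h : A -> B) t : prism g h (fun=> 0) t = 0.
  by elim: t => //= x t ->.
rewrite !p0 !map_id !addr0 in e1 e2.
have e3 : list_delta (fun s => prism id id c (map (pair k) (map (shift k) s))) s = 0.
  rewrite (list_delta_map (shift k) (fun s => prism id id c (map (pair k) s))).
  by rewrite (list_delta_map (pair k) (prism id id c)) e1 subrr.
rewrite e3 subr0 e2 -map_comp; ring.
Qed.

Let delta_level k u s :
  (forall a, a \in s -> near k u a) ->
  list_delta (level k) s = c (map (pair k) s).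
Proof.
elim: k s => [|k IH] s hs.
  rewrite /= (list_delta_map (pair 0%N) (fun t => c ((0%N, z) :: t))).
  have := @delta_c 0%N u ((0%N, z) :: map (pair 0%N) s).
  move=> /= /(_ _) h; apply/esym/eqP; rewrite -subr_eq0 h // => p.
  rewrite inE => /orP[/eqP->|/mapP[a /hs na ->]]; by split; [left|].
rewrite /= (list_delta_map (pair k.+1) (mixed k (level k))).
apply: (@delta_mixed k u) => [t ht|p /mapP[a /hs na ->]]; first exact: IH.
by split; [right|].
Qed.

(** The term [C] bounds the constant simplices and [q%:Z] the remainders of the floored average. The
    three terms [q%:Z * C] bound the averaged prism of [list_delta beta] and the two correction
    prisms. *)
Let D : int := C + q%:Z + 3 * (q%:Z * C).

Let C_ge0 : 0 <= C.
Proof. exact: le_trans (normr_ge0 _) (normr_c [::]). Qed.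

Let prism_c_le (A : eqType) (g h : A -> nat * Z) (s : seq A) :
  `|prism g h c s| <= (size s)%:Z * C.
Proof. by apply: (normr_prism (Q := fun=> True)). Qed.

Let level_step k B s u :
  (forall u t, (forall a, a \in t -> near k u a) -> size t = q ->
    `|level k t| <= B) ->
  (forall a, a \in s -> near k.+1 u a) -> size s = q ->
  (#|W k|)%:Z * `|level k.+1 s| <=
    (#|[set w : W k | ~~ constant (map (f w) s)]|)%:Z * B + (#|W k|)%:Z * D.
Proof.
set M := (#|W k|)%:Z; set bad := [set w | _].
move=> hB hs sq.
have M0 : 0 < M by rewrite ltz_nat.
pose beta := level k.
pose H t := \sum_(w : W k) prism (f (w0 k)) (f w) beta t.
pose P1 := prism id id c (map (pair k) (map (f (w0 k)) s)).
pose P2 := prism (fun p => (k, shift k p)) id c (map (pair k.+1) s).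
have e0 : level k.+1 s = beta (map (f (w0 k)) s) - P1 + P2
    + list_delta (fun t => (H t %/ M)%Z) s.
  have em : map (shift k) (map (pair k.+1) s) = map (f (w0 k)) s.
    by rewrite -map_comp; apply/eq_map => a; rewrite /= /shift /= gtn_eqF.
  rewrite /= /mixed em -/P1 -/P2 -/beta; congr (_ + _).
  rewrite -list_delta_map; apply: eq_list_delta => t.
  rewrite all_map (eq_all (a2 := predT)) ?all_predT; last by move=> a /=; rewrite eqxx.
  by rewrite -map_comp map_id_in.
(* Flooring the average costs a remainder modulo [M], which contributes at most [q] after division
   by [M]. *)
have e1 : M * list_delta (fun t => (H t %/ M)%Z) s =
    list_delta H s - list_delta (fun t => (H t %% M)%Z) s.
  rewrite -list_deltaMl -list_deltaN -list_deltaD; apply: eq_list_delta => t.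
  by rewrite {2}(divz_eq (H t) M); ring.
have e2 : list_delta H s + \sum_(w : W k) prism (f (w0 k)) (f w) (list_delta beta) s =
    \sum_(w : W k) beta (map (f w) s) - M * beta (map (f (w0 k)) s).
  rewrite list_delta_sum -big_split /= (eq_bigr _ (fun w _ => prism_homotopy _ _ _ _)).
  by rewrite sumrB; congr (_ - _); rewrite sumr_const -mulr_natl natz.
have e3 : M * level k.+1 s = \sum_(w : W k) beta (map (f w) s)
   - \sum_(w : W k) prism (f (w0 k)) (f w) (list_delta beta) s
   - list_delta (fun t => (H t %% M)%Z) s + M * (P2 - P1).
  by rewrite e0 !mulrDr e1; lra.
have nf w a : a \in map (f (w : W k)) s -> near k u a.
  by case/mapP=> y /hs ny ->; apply: near_f.
have b1 : `|\sum_(w : W k) beta (map (f w) s)| <= (#|bad|)%:Z * B + M * C.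
  rewrite (bigID [in bad]) /= (le_trans (ler_normD _ _)) // lerD //.
    rewrite (le_trans (ler_norm_sum _ _ _)) // (le_trans (ler_sum (G := fun=> B) _ _)) //.
      by move=> w _; apply: (hB u); [exact: nf|rewrite size_map].
    by rewrite sumr_const -mulr_natl natz.
  rewrite (le_trans (ler_norm_sum _ _ _)) // (le_trans (ler_sum (G := fun=> C) _ _)) //.
    move=> w; rewrite inE negbK => cw.
    have [x ex] : exists x, map (f w) s = nseq q x.
      move: cw; have /esym := size_map (f w) s; rewrite sq.
      case: (map (f w) s) => [q0|x t st /= /all_pred1P ->]; first by move: q_gt0; rewrite q0.
      by exists x; rewrite st.
    (* As [q] is even, [beta] on a constant simplex equals its coboundary one dimension up, a value
       of [c]; this bound does not involve [B]. *)
    have /(delta_level (k := k)) : forall a, a \in nseq q.+1 x -> near k u a.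
      move=> a; rewrite mem_nseq => /andP[_ /eqP->]; apply: (nf w).
      by rewrite ex mem_nseq q_gt0 eqxx.
    by rewrite list_delta_nseq (negbTE q_even) ex /beta => ->.
  rewrite sumr_const -mulr_natl natz ler_wpM2r // lez_nat; exact: max_card.
have b2 : `|\sum_(w : W k) prism (f (w0 k)) (f w) (list_delta beta) s| <= M * (q%:Z * C).
  rewrite (le_trans (ler_norm_sum _ _ _)) //.
  rewrite (le_trans (ler_sum (G := fun=> q%:Z * C) _ _)) //; last first.
    by rewrite sumr_const -mulr_natl natz.
  move=> w _; rewrite -sq; apply: (normr_prism (Q := near k u)) => [t ht _|x /hs nx].
    by rewrite (delta_level ht).
  by split; apply: near_f.
have b3 : `|list_delta (fun t => (H t %% M)%Z) s| <= q%:Z * M.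
  rewrite -sq; apply: normr_list_delta => t _ _.
  by rewrite ger0_norm ?modz_ge0 ?gt_eqF // ltW // ltz_pmod.
have b4 : `|P1| <= q%:Z * C.
  by rewrite (le_trans (prism_c_le _ _ _)) // !size_map sq.
have b5 : `|P2| <= q%:Z * C.
  by rewrite (le_trans (prism_c_le _ _ _)) // !size_map sq.
have b6 : `|M * (P2 - P1)| <= 2 * (M * (q%:Z * C)).
  rewrite normrM (gtr0_norm M0) mulrCA ler_wpM2l ?(ltW M0) //.
  by rewrite (le_trans (ler_normB _ _)) //; lra.
rewrite -[X in X * `|_|](gtr0_norm M0) -normrM e3 /D.
apply: le_trans (ler_normD _ _) _.
have h1 := ler_normB (\sum_(w : W k) beta (map (f w) s)
   - \sum_(w : W k) prism (f (w0 k)) (f w) (list_delta beta) s)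
   (list_delta (fun t => (H t %% M)%Z) s).
have h2 := ler_normB (\sum_(w : W k) beta (map (f w) s))
   (\sum_(w : W k) prism (f (w0 k)) (f w) (list_delta beta) s).
lra.
Qed.

(** Up to level [k0] each step may add [D] to the bound. From there on at most half of the old bound
    survives, and [B + 2 * D] reproduces itself because [(B + 2 * D) / 2 + D <= B + 2 * D]. *)
Let level_bounded : exists2 B, 0 <= B & forall k u s,
  (forall a, a \in s -> near k u a) -> size s = q -> `|level k s| <= B.
Proof.
have D0 : 0 <= D by rewrite /D !addr_ge0 ?mulr_ge0.
have fin k : exists2 B, 0 <= B & forall j u s, (j <= k)%N ->
    (forall a, a \in s -> near j u a) -> size s = q -> `|level j s| <= B.
  elim: k => [|k [B B0 IH]].
    by exists C => // j u s; rewrite leqn0 => /eqP-> _ _; apply: normr_c.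
  exists (B + D); first exact: addr_ge0.
  move=> j u s; rewrite leq_eqVlt => /orP[/eqP->|jk] ns ss; last first.
    by rewrite (le_trans (IH j u s _ ns ss)) // lerDl.
  have M0 : 0 < (#|W k|)%:Z by rewrite ltz_nat.
  have hk u' t : (forall a, a \in t -> near k u' a) -> size t = q ->
      `|level k t| <= B by move=> nt st; apply: (IH k u').
  rewrite -(ler_pM2l M0) (le_trans (level_step hk ns ss)) //.
  rewrite (mulrDr _ B) lerD2r ler_wpM2r // lez_nat; exact: max_card.
have [B B0 hB] := fin k0.
exists (B + 2 * D); first by rewrite addr_ge0 // mulr_ge0.
elim=> [|k IH] u s ns ss.
  by rewrite (le_trans (hB 0%N u s _ ns ss)) // lerDl mulr_ge0.
have [kk0|k0k] := leqP k.+1 k0.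
  by rewrite (le_trans (hB _ u s _ ns ss)) // lerDl mulr_ge0.
have M0 : 0 < (#|W k|)%:Z by rewrite ltz_nat.
have h1 := level_step IH ns ss.
have h2 := scatter_le k0k ns ss.
set M := (#|W k|)%:Z in M0 h1; set m := #|[set w : W k | _]| in h1 h2.
have {}h2 : 2 * m%:Z <= M by rewrite /M -PoszM lez_nat.
rewrite -(ler_pM2l M0).
have h3 : 2 * m%:Z * (B + 2 * D) <= M * (B + 2 * D).
  by rewrite ler_wpM2r // addr_ge0 // mulr_ge0.
have h4 : 0 <= M * B by rewrite mulr_ge0 // ltW.
move: h1 h3 h4; rewrite !mulrDr; set x := `|_|.
lia.
Qed.

(** On simplices of level [k] the two prisms agree and cancel, so the primitives on consecutive
    pairs of levels glue. *)
Let mixed_pure k beta t : mixed k beta (map (pair k) t) = beta t.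
Proof.
have e : map (shift k) (map (pair k) t) = t.
  by rewrite -map_comp map_id_in // => a _; rewrite /= /shift eqxx.
rewrite /mixed e.
rewrite (@eq_prism_fun _ _ (fun p => (k, shift k p)) id id id); first last.
- by [].
- by move=> p /mapP[a _ ->]; rewrite /shift /= eqxx.
rewrite (eq_in_list_delta (c' := fun=> 0)); last first.
  move=> [|p r] sr _ /=.
    (* The empty face passes the test [all] vacuously, but every prism vanishes on it. *)
    by rewrite /avg big1 ?div0z.
  have /mapP[a _ ->] := sr p (mem_head _ _).
  by rewrite /= ltn_eqF.
have -> : list_delta (fun=> 0) (map (pair k) t) = 0 :> int.
  by move: (map _ t) => {e t}; elim => //= x s ->.
by rewrite subrK addr0.
Qed.

Definition min_level (s : seq (nat * Z)) := foldr minn (head (0%N, z) s).1 (map fst s).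

(** The only ambiguity is a simplex lying entirely on level [j.+1], whose minimal level is [j.+1];
    there [mixed_pure] identifies both formulas. *)
Let min_levelE j u s : s != [::] -> (forall p, p \in s -> near_pair j u p) ->
  mixed (min_level s) (level (min_level s)) s = mixed j (level j) s.
Proof.
move=> s0 hs.
have [/allP sj|nsj] := boolP (all (fun p => p.1 == j.+1) s).
  have -> : min_level s = j.+1.
    rewrite /min_level; case: s s0 sj {hs} => //= p s _ sj.
    have /eqP p1 := sj p (mem_head _ _); rewrite p1.
    have : forall q, q \in s -> q.1 == j.+1.
      by move=> r rs; apply: sj; rewrite inE rs orbT.
    elim: s {sj} => [_|r s IH sj] /=; first by rewrite minnn.
    have /eqP r1 := sj r (mem_head _ _).
    rewrite r1 IH ?minnn // => x xs; apply: sj; by rewrite inE xs orbT.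
  have es : s = map (pair j.+1) (map snd s).
    rewrite -map_comp map_id_in // => p ps.
    by have /eqP <- := sj p ps; case: (p).
  by rewrite {1}es mixed_pure /= -es.
suff -> : min_level s = j by [].
have ge x : (j <= x)%N -> (j <= foldr minn x (map fst s))%N.
  move=> jx; elim: s {s0 nsj} hs => //= p s IH hs.
  rewrite leq_min; have [+ _] := hs p (mem_head _ _).
  move=> p1; apply/andP; split; first by case: p1 => ->.
  by apply: IH => r rs; apply: hs; rewrite inE rs orbT.
apply/eqP; rewrite eqn_leq; apply/andP; split; last first.
  apply: ge; clear nsj; case: s s0 hs => // p s _ hs.
  by have [+ _] := hs p (mem_head _ _); case=> ->.
have /allPn[p ps pj] := nsj.
have pj' : p.1 = j by have [+ _] := hs p ps; case=> // e; rewrite e eqxx in pj.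
rewrite /min_level; move: (head _ _) => x.
elim: s ps {s0 nsj ge hs} => //= r s IH.
rewrite inE => /orP[/eqP <-|/IH le]; first by rewrite pj' geq_minl.
by rewrite (leq_trans (geq_minr _ _)).
Qed.

(** The averaging term may be estimated crudely here, since passing from pure to mixed simplices is
    done once and not iterated. *)
Lemma bounded_primitive : exists (b : seq (nat * Z) -> int) (B : int),
  forall j u s, (forall p, p \in s -> near_pair j u p) ->
    (size s = q -> `|b s| <= B) /\ (size s = q.+1 -> list_delta b s = c s).
Proof.
have [B B0 hB] := level_bounded.
exists (fun s => mixed (min_level s) (level (min_level s)) s).
exists (B + q%:Z * C + q%:Z * C + q%:Z * (q%:Z * B)) => j u s hs; split=> ss; last first.
  rewrite -(delta_mixed (k := j) (u := u) (beta := level j)) //; last first.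
    by move=> t; apply: delta_level.
  apply: eq_in_list_delta => t ts st; apply: (min_levelE (u := u)).
    by apply/negP => /eqP t0; move: st; rewrite t0 ss /= => -[q0]; move: q_gt0; rewrite q0.
  by move=> p /ts; apply: hs.
rewrite (min_levelE (u := u) _ hs); last first.
  by apply/negP => /eqP s0; move: ss; rewrite s0 /= => q0; move: q_gt0; rewrite -q0.
rewrite /mixed (le_trans (ler_normD _ _)) // lerD //.
  rewrite (le_trans (ler_normD _ _)) // lerD //; last first.
    by rewrite -ss prism_c_le.
  rewrite (le_trans (ler_normB _ _)) // lerD //.
    apply: (hB _ u); last by rewrite size_map.
    by move=> a /mapP[p /hs np ->]; apply: near_shift.
  by rewrite (le_trans (prism_c_le _ _ _)) // !size_map ss.
rewrite -ss; apply: normr_list_delta => t ts st.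
case: ifP => [/allP ht|_]; last by rewrite normr0 !mulr_ge0.
have nt a : a \in map snd t -> near j.+1 u a.
  case/mapP=> p pt ->; have [_] := hs p (ts p pt).
  by have /eqP -> := ht p pt.
have M0 : 0 < (#|W j|)%:Z by rewrite ltz_nat.
have hH : `|\sum_(w : W j) prism (f (w0 j)) (f w) (level j) (map snd t)|
    <= (size s)%:Z * B * (#|W j|)%:Z.
  rewrite (le_trans (ler_norm_sum _ _ _)) //.
  rewrite (le_trans (ler_sum (G := fun=> (size s)%:Z * B) _ _)) //; last first.
    by rewrite sumr_const -mulr_natr natz.
  move=> w _; rewrite (@le_trans _ _ ((size (map snd t))%:Z * B)) //; last first.
    by rewrite ler_wpM2r // size_map st lez_nat.
  apply: (normr_prism (Q := near j u)) => [r hr sr|a /nt na].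
    by apply: (hB _ u) => //; rewrite sr size_map -ss st.
  by split; apply: near_f.
rewrite /avg ler_norml; move: hH; rewrite ler_norml => /andP[h1 h2].
apply/andP; split; first by rewrite lez_divRL // mulNr.
by rewrite -ltzD1 ltz_divLR // mulrDl mul1r (le_lt_trans h2) // ltrDl.
Qed.

End Tower.

(** * Random rounding of lattice points *)

Section Rounding.
Local Open Scope ring_scope.

(** Raising [A] by 1 shifts the summation index: the term [A %/ m] is traded for [(A + m) %/ m],
    which is larger by 1. *)
Lemma sum_divzS (m : nat) (A : int) : (0 < m)%N ->
  \sum_(w < m) ((A + 1 + w%:Z) %/ m%:Z)%Z = \sum_(w < m) ((A + w%:Z) %/ m%:Z)%Z + 1.
Proof.
case: m => // m _.
rewrite big_ord_recr [in RHS]big_ord_recl /= addr0.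
have -> : A + 1 + m%:Z = 1 * m.+1%:Z + A by rewrite mul1r -addn1 PoszD; ring.
rewrite divzMDl // [RHS]addrAC [in RHS]addrC [1 + _]addrC; congr (_ + (_ + _)).
by apply: eq_bigr => w _; rewrite /bump /= add1n -addn1 PoszD; congr (_ %/ _)%Z; ring.
Qed.

Lemma sum_divzD (m : nat) (A : int) (B : nat) : (0 < m)%N ->
  \sum_(w < m) ((A + B%:Z + w%:Z) %/ m%:Z)%Z
    = \sum_(w < m) ((A + w%:Z) %/ m%:Z)%Z + B%:Z.
Proof.
move=> m0; elim: B => [|B IH]; first by rewrite !addr0.
have e : A + B.+1%:Z = A + B%:Z + 1 by rewrite -addn1 PoszD addrA.
by rewrite e sum_divzS // IH -addn1 PoszD addrA.
Qed.

(** The quotients grow with [A], each disagreement contributes at least 1 to the growth, and the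
    total growth is [B] by [sum_divzD]. *)
Lemma card_divz_neq (m : nat) (A : int) (B : nat) : (0 < m)%N ->
  (#|[set w : 'I_m | ((A + w%:Z) %/ m%:Z)%Z != ((A + B%:Z + w%:Z) %/ m%:Z)%Z]| <= B)%N.
Proof.
move=> m0; rewrite -lez_nat.
have eB : B%:Z = \sum_(w < m) ((A + B%:Z + w%:Z) %/ m%:Z)%Z
    - \sum_(w < m) ((A + w%:Z) %/ m%:Z)%Z.
  by rewrite (sum_divzD _ _ m0) addrAC subrr add0r.
rewrite [leRHS]eB -sumrB -sum1_card -natz natr_sum big_mkcond /=; apply: ler_sum => w _.
have mono : ((A + w%:Z) %/ m%:Z <= (A + B%:Z + w%:Z) %/ m%:Z)%Z.
  by apply: lez_pdiv2r => //; lia.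
rewrite inE; case: eqP => [->|/eqP ne] /=; first by rewrite subrr.
by move: mono ne; move: (divz _ _) (divz _ _) => x y; lia.
Qed.

Variables (R : archiRealFieldType) (n : nat) (N : nat -> nat).
Hypothesis N_gt0 : forall k, (0 < N k.+1)%N.
Hypothesis N_step : forall k, N k = N k.+1 \/ (2 * N k <= N k.+1)%N.

Definition lattice_near k (u : 'rV[R]_n) (a : {ffun 'I_n -> int}) :=
  forall i, `|(a i)%:~R - (N k)%:R * u ord0 i| <= 2.

Definition round_down k (w : 'I_(N k.+1)) (a : {ffun 'I_n -> int}) : {ffun 'I_n -> int} :=
  [ffun i => ((a i * (N k)%:Z + w%:Z) %/ (N k.+1)%:Z)%Z].

(** The tolerance 2 reproduces itself: the old error shrinks by a factor of at most 1/2 and the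
    shifted floor adds at most 1. For equal meshes the rounding is the identity. *)
Lemma lattice_near_round k u (w : 'I_(N k.+1)) a :
  lattice_near k.+1 u a -> lattice_near k u (round_down w a).
Proof.
move=> h i; have {h} := h i; rewrite ffunE; set x := u ord0 i.
have N0 := N_gt0 k; have := ltn_ord w; set M := N k.+1 in N0 w *; set m := N k => wM.
have M0 : (0 : R) < M%:R by rewrite ltr0n.
have := N_step k; rewrite -/M -/m; case=> [->|].
  move=> h; by rewrite divzMDl ?divz_small ?addr0 //; lia.
move=> mM h; set v := (_ %/ _)%Z.
have h1 : v * M%:Z <= a i * m%:Z + w%:Z by rewrite lez_floor // gt_eqF // ltz_nat.
have h2 : a i * m%:Z + w%:Z < (v + 1) * M%:Z by rewrite ltz_ceil // ltz_nat.
move: h1 h2; rewrite -(ler_int R) -(ltr_int R) !rmorphD !rmorphM rmorphD /= -!pmulrn => h1 h2.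
have h3 : 2 * m%:R <= M%:R :> R by rewrite -natrM ler_nat.
have h4 : w%:R < M%:R :> R by rewrite ltr_nat.
have h5 : (0 : R) <= w%:R by [].
have h6 : (0 : R) <= m%:R by [].
move: h; rewrite !ler_norml => /andP[a1 a2].
have a3 : -2 * m%:R <= ((a i)%:~R - M%:R * x) * m%:R by rewrite ler_wpM2r.
have a4 : ((a i)%:~R - M%:R * x) * m%:R <= 2 * m%:R by rewrite ler_wpM2r.
by rewrite -(ler_pM2r M0) -(ler_pM2r M0 _ 2); apply/andP; split; lra.
Qed.

(** In each coordinate the vertices lie in a window [[m i, m i + 4]], of length [4 * N k] after
    scaling by [N k]. The bound follows from [card_divz_neq] and a union over the [n]
    coordinates. *)
Lemma scatter_round k u (s : seq {ffun 'I_n -> int}) :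
  (forall a, a \in s -> lattice_near k.+1 u a) ->
  (#|[set w : 'I_(N k.+1) | ~~ constant (map (round_down w) s)]| <= n * (4 * N k))%N.
Proof.
move=> hs; pose m i := Num.floor ((N k.+1)%:R * u ord0 i - 2).
have hm a i : a \in s -> m i <= a i <= m i + 4.
  move=> /hs/(_ i); rewrite ler_norml => /andP[h1 h2].
  have := floor_itv ((N k.+1)%:R * u ord0 i - 2 : R); rewrite -/(m i) => /andP[h3 h4].
  apply/andP; split.
    by rewrite -ltzD1 -(ltr_int R) rmorphD /=; lra.
  rewrite -ltzD1 -(ltr_int R); rewrite !rmorphD /= in h4 *; lra.
pose bad i := [set w : 'I_(N k.+1) |
   ((m i * (N k)%:Z + w%:Z) %/ (N k.+1)%:Z)%Z
     != ((m i * (N k)%:Z + (4 * N k)%N%:Z + w%:Z) %/ (N k.+1)%:Z)%Z].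
apply: (@leq_trans #|\bigcup_i bad i|).
  apply/subset_leq_card/fintype.subsetP => w; rewrite inE => nc.
  apply/finset.bigcupP/exists_inP; rewrite -[X in is_true X]negbK; apply/negP => /exists_inPn gd.
  move: nc => /negP; apply; case: s hs hm => //= a s hs hm.
  have eq b : b \in a :: s -> round_down w b =
      [ffun i => ((m i * (N k)%:Z + w%:Z) %/ (N k.+1)%:Z)%Z].
    move=> bs; apply/ffunP => i; rewrite !ffunE.
    have := gd i isT; rewrite inE negbK => /eqP e.
    have /andP[b1 b2] := hm b i bs.
    apply/eqP; rewrite eq_le [X in _ && X]lez_pdiv2r ?lerD2r ?ler_wpM2r // andbT.
    rewrite e lez_pdiv2r // lerD2r PoszM -mulrDl ler_wpM2r //.
  rewrite (eq a) ?mem_head //; apply/all_pred1P/all_pred1P => /=.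
  by apply/allP => x /mapP[b bs ->] /=; rewrite eq // inE bs orbT.
apply: (@leq_trans (\sum_(i < n) 4 * N k)); last by rewrite sum_nat_const card_ord.
apply: (big_rec2 (fun (A : {set _}) x => #|A| <= x)%N); first by rewrite cards0.
move=> i A x _ hx; rewrite (leq_trans (leq_card_setU _ _)) // leq_add //.
exact: card_divz_neq.
Qed.

End Rounding.

(** * Finite labels *)

Section CechLists.
Local Open Scope ring_scope.

Lemma list_deltaE (T : Type) (c : seq T -> int) s :
  list_delta c s = \sum_(j < size s) (-1) ^+ j * c (take j s ++ drop j.+1 s).
Proof.
elim: s c => [|x s IH] c; first by rewrite big_ord0.
rewrite [size _]/= big_ord_recl /= mul1r drop0 IH -sumrN; congr (_ + _).
by apply: eq_bigr => j _; rewrite /bump /= add1n exprS mulN1r mulNr.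
Qed.

Lemma cech_delta_codom (T : Type) (r : nat) (b : seq T -> int) (s : 'I_r.+2 -> T) :
  cech_delta (fun t : 'I_r.+1 -> T => b (codom t)) s = list_delta b (codom s).
Proof.
rewrite list_deltaE /cech_delta size_codom card_ord; apply: eq_bigr => j _.
congr (_ * b _).
have sz : size (codom s) = r.+2 by rewrite size_codom card_ord.
have nc (m : nat) (t : 'I_m -> T) i (im : (i < m)%N) : nth (s ord0) (codom t) i = t (Ordinal im).
  rewrite /codom /image_mem (nth_map (Ordinal im)) ?size_enum_ord //.
  by congr t; apply: val_inj; rewrite /= nth_enum_ord.
have jr := ltn_ord j.
apply: (@eq_from_nth _ (s ord0)).
  rewrite size_codom card_ord size_cat size_take size_drop sz jr; lia.
move=> i; rewrite size_codom card_ord => ir.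
rewrite nc nth_cat size_take sz jr.
have [ij|ji] := ltnP i j.
  rewrite nth_take // (nc _ s i (ltn_trans ij jr)).
  by congr s; apply: val_inj; rewrite /= /bump leqNgt ij.
have ir' : (i.+1 < r.+2)%N by [].
rewrite nth_drop addSn subnKC // (nc _ s _ ir').
by congr s; apply: val_inj; rewrite /= /bump ji.
Qed.

(** Extension by zero to lists of other lengths, so that cochains of all degrees have one type. *)
Definition list_cochain (T : Type) (x0 : T) r (c : ('I_r -> T) -> int) (l : seq T) : int :=
  if size l == r then c (fun i => nth x0 l i) else 0.

Lemma list_cochain_codom (T : Type) (x0 : T) r (c : ('I_r -> T) -> int) t :
  list_cochain x0 c (codom t) = c t.
Proof.
rewrite /list_cochain size_codom card_ord eqxx; congr c; apply/funext => i.
rewrite /codom /image_mem (nth_map i) ?size_enum_ord //.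
by congr t; apply: val_inj; rewrite /= nth_enum_ord.
Qed.

Lemma list_delta_cochain (T : Type) (x0 : T) r (c : ('I_r.+1 -> T) -> int) l :
  list_delta (list_cochain x0 c) l =
    if size l == r.+2 then cech_delta c (fun i => nth x0 l i) else 0.
Proof.
case: ifPn => [/eqP sl|sl]; last first.
  rewrite list_deltaE big1 // => j _; rewrite /list_cochain size_cat size_take size_drop.
  rewrite ltn_ord ifN ?mulr0 //.
  have := ltn_ord j; move: sl; lia.
rewrite (_ : c = fun t => list_cochain x0 c (codom t)); last first.
  by apply/funext => t; rewrite list_cochain_codom.
rewrite cech_delta_codom; congr (list_delta _ _).
  by apply/funext => t; congr list_cochain; apply/funext => u; rewrite list_cochain_codom.
apply: (@eq_from_nth _ x0); first by rewrite size_codom card_ord.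
move=> i; rewrite sl => ir; rewrite /codom /image_mem (nth_map (Ordinal ir)) ?size_enum_ord //.
by rewrite nth_enum_ord.
Qed.
End CechLists.

Section Labels.
Local Open Scope ring_scope.
Variables (R : realType) (n : nat) (N : nat -> nat) (S : 'rV[R]_n -> Prop).
Hypothesis N_mono : forall k, (N k <= N k.+1)%N.

Notation Z := {ffun 'I_n -> int}.
Let U := {u : 'rV[R]_n | S u}.
Let near k (u : U) := lattice_near N k (sval u).
Let good (s : seq (nat * Z)) := exists j u, forall p, p \in s -> near_pair near j u p.

Variables (q m : nat) (b : seq (nat * Z) -> int) (B : nat) (lam : nat * Z -> 'I_m).
Hypothesis normr_b : forall s, good s -> size s = q -> `|b s| <= B%:Z.

(** Two vertices sharing simplices with [p], of level at most that of [p], differ by at most 1 in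
    level and, on equal levels, by at most 8 in each coordinate. The modulus 3 also tells which of
    two adjacent levels is the higher one. *)
Definition color (p : nat * Z) : 'I_3 * {ffun 'I_n -> 'I_9} :=
  (inord (p.1 %% 3), [ffun i => inord `|(p.2 i %% 9)%Z|]).

Definition below (p p' : nat * Z) := good [:: p; p'] /\ (p'.1 <= p.1)%N.

(* The level of [p'] is at most that of [p], hence its mesh is coarser: this is
   what makes the vertex [p'] recoverable from [p] and a colour. *)
Lemma below_inj p p' p'' : below p p' -> below p p'' -> color p' = color p'' -> p' = p''.
Proof.
case: p => k a; case: p' => k' a'; case: p'' => k'' a''.
move=> [[j [u gp]] /= h1] [[j' [u' gp']] /= h2] [] /(congr1 val) ek /ffunP ea.
have [l1 n1] : near_pair near j u (k, a) by apply: gp; rewrite inE eqxx.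
have [l2 n2] : near_pair near j u (k', a') by apply: gp; rewrite !inE eqxx orbT.
have [l3 n3] : near_pair near j' u' (k, a) by apply: gp'; rewrite inE eqxx.
have [l4 n4] : near_pair near j' u' (k'', a'') by apply: gp'; rewrite !inE eqxx orbT.
rewrite /= in l1 l2 l3 l4 n1 n2 n3 n4.
have ekk : k' = k''.
  by move: ek; rewrite /= !inordK ?ltn_mod //; lia.
subst k''; congr (_, _); apply/ffunP => i.
have := ea i; rewrite !ffunE => /(congr1 val) /=; rewrite !inordK; try lia.
move=> e9.
have leN : (N k' <= N k)%N.
  have : (k' = k) \/ (k = k'.+1) by lia.
  by case=> [->|->].
have m1 := n1 i; have m2 := n2 i; have m3 := n3 i; have m4 := n4 i.
rewrite /= in m1 m2 m3 m4.
set x := sval u ord0 i in m1 m2; set y := sval u' ord0 i in m3 m4.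
have d1 : `|(N k)%:R * (x - y)| <= 4.
  by move: m1 m3; rewrite !ler_norml => /andP[? ?] /andP[? ?]; apply/andP; split; lra.
have d2 : `|(N k')%:R * (x - y)| <= 4.
  by rewrite (le_trans _ d1) // !normrM ler_wpM2r // !ger0_norm // ler_nat.
have d3 : `|a' i - a'' i| <= 8.
  rewrite -(ler_int R) intr_norm rmorphB /=.
  move: m2 m4 d2; rewrite !ler_norml => /andP[? ?] /andP[? ?] /andP[? ?].
  by apply/andP; split; lra.
lia.
Qed.

Let decode p (g : 'I_3 * {ffun 'I_n -> 'I_9}) : nat * Z :=
  xget p [set p' | below p p' /\ color p' = g]%classic.

Let decodeK p p' : below p p' -> decode p (color p') = p'.
Proof.
move=> pp'; rewrite /decode; case: xgetP => [x _ [bx cx]|/(_ p')]; first exact: below_inj bx pp' cx.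
by move=> /(_ (conj pp' erefl)).
Qed.

(** The values of [b] on the simplices of size [q] as seen from a vertex [p] of highest level,
    indexed by colours. Adding [B] moves them into [0, ..., 2 * B]. *)
Let table p : {ffun q.-tuple ('I_3 * {ffun 'I_n -> 'I_9}) -> 'I_(2 * B).+1} :=
  [ffun t : q.-tuple _ => inord `|b (map (decode p) t) + B%:Z|].

Definition label p := (color p, lam p, table p).

Let is_top (s : seq (nat * Z)) (p : nat * Z) := forall p', p' \in s -> (p'.1 <= p.1)%N.

Let table_top s p (sq : size s = q) : good s -> p \in s -> is_top s p ->
  table p (tcast sq (map_tuple color (in_tuple s))) = inord `|b s + B%:Z|.
Proof.
move=> gs ps tp; rewrite ffunE val_tcast /= -map_comp map_id_in // => p' ps'.
apply: decodeK; split; last exact: tp.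
case: gs => j [u gs]; exists j, u => r; rewrite !inE => /orP[/eqP->|/eqP->]; exact: gs.
Qed.

(** Among two adjacent levels the order is visible modulo 3, so a top vertex can be recognised from
    colours alone. *)
Let leq_mod3 (x y j : nat) : x = j \/ x = j.+1 -> y = j \/ y = j.+1 ->
  (x <= y)%N = (x %% 3 != y.+1 %% 3)%N.
Proof. by lia. Qed.

Let shift_inj (x y : int) : `|x| <= B%:Z -> `|y| <= B%:Z ->
  (`|(x + B%:Z)%R|%N < (2 * B).+1)%N /\
  (`|(x + B%:Z)%R|%N = `|(y + B%:Z)%R|%N -> x = y).
Proof. by lia. Qed.

Let modS3 (x y : nat) : (x %% 3 = y %% 3)%N -> (x.+1 %% 3 = y.+1 %% 3)%N.
Proof. by lia. Qed.

Let color_level (p : nat * Z) (k : nat) :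
  ((color p).1 == inord (k %% 3)) = (p.1 %% 3 == k %% 3)%N.
Proof. by rewrite -(inj_eq val_inj) /= !inordK ?ltn_mod. Qed.

Let top_color s p : good s -> p \in s -> is_top s p <->
  forall p', p' \in s -> (color p').1 != inord (p.1.+1 %% 3).
Proof.
case=> j [u gs] ps; have [lp _] := gs p ps; split=> h p' ps'.
  by have [lp' _] := gs p' ps'; rewrite color_level -(leq_mod3 lp' lp); apply: h.
by have [lp' _] := gs p' ps'; rewrite (leq_mod3 lp' lp) -color_level; apply: h.
Qed.

Let top_exists s : s != [::] -> exists2 p, p \in s & is_top s p.
Proof.
elim: s => //= p s IH _; have [->|/IH [p' ps' tp']] := eqVneq s [::].
  by exists p; rewrite ?mem_head // => p'; rewrite inE => /eqP->.
have [le|lt] := leqP p'.1 p.1.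
  exists p; rewrite ?mem_head // => r; rewrite inE => /orP[/eqP->//|/tp' h].
  exact: leq_trans h le.
exists p'; first by rewrite inE ps' orbT.
by move=> r; rewrite inE => /orP[/eqP->|/tp' //]; exact: ltnW.
Qed.

(** Equal colours put a top vertex at the same position of both lists; its table, evaluated at the
    common tuple of colours, gives both values of [b]. *)
Lemma label_determines s s' : (0 < q)%N -> size s = q -> good s -> good s' ->
  map label s = map label s' -> b s = b s'.
Proof.
move=> q0 sq gs gs' e.
have s0 : s != [::] by apply: contraTneq q0 => s0; rewrite -sq s0.
have ss : size s' = size s by rewrite -[RHS](size_map label) e size_map.
have s'q : size s' = q by rewrite ss.
have ec : map color s = map color s'.
  have := congr1 (map (fun l => l.1.1)) e; rewrite -!map_comp.
  by rewrite (eq_map (g := color)) // => ->; apply: eq_map.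
have [p ps tp] := top_exists s0.
pose i := index p s; have is_ : (i < size s)%N by rewrite index_mem.
pose p' := nth p s' i.
have ps' : p' \in s' by rewrite mem_nth // ss.
have el : label p = label p'.
  have := congr1 (fun l => nth (label p) l i) e.
  by rewrite /= !(nth_map p) ?ss // nth_index.
have ecp : color p = color p' by have := congr1 (fun l => l.1.1) el.
have tp' : is_top s' p'.
  apply/(top_color gs' ps') => r rs.
  have : color r \in map color s by rewrite ec; apply: map_f.
  case/mapP=> r' rs' er; move/(top_color gs ps): tp => /(_ r' rs').
  suff -> : (p'.1.+1 %% 3 = p.1.+1 %% 3)%N by rewrite er.
  have : (color p).1 == inord (p'.1 %% 3) by rewrite ecp color_level.
  by rewrite color_level => /eqP /modS3.
have et : table p = table p' by have := congr1 (fun l => l.2) el.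
have h1 := table_top sq gs ps tp; have h2 := table_top s'q gs' ps' tp'.
have ett : tcast sq (map_tuple color (in_tuple s)) = tcast s'q (map_tuple color (in_tuple s')).
  by apply: val_inj; rewrite /= !val_tcast.
move: h2; rewrite -et -ett h1 => /(congr1 val) /=.
have [lt eq] := shift_inj (normr_b gs sq) (normr_b gs' s'q).
have [lt' _] := shift_inj (normr_b gs' s'q) (normr_b gs sq).
by rewrite !inordK // => /eq.
Qed.

End Labels.

Section LabelledPrimitive.
Local Open Scope ring_scope.

Lemma labelled_primitive (R : realType) (n : nat) (N : nat -> nat)
    (S : 'rV[R]_n -> Prop) (q m : nat)
    (lam : nat * {ffun 'I_n -> int} -> 'I_m) (c : seq 'I_m -> int) :
  N 0%N = 0%N -> (forall k, (0 < N k.+1)%N) ->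
  (forall k, N k = N k.+1 \/ (2 * N k <= N k.+1)%N) ->
  (exists k0, forall k, (k0 <= k)%N -> (8 * n * N k <= N k.+1)%N) ->
  ~~ odd q -> (0 < q)%N ->
  (forall s, size s != q.+1 -> c s = 0) ->
  let near k (u : {u | S u}) := lattice_near N k (sval u) in
  (forall j u s, (forall p, p \in s -> near_pair near j u p) ->
    list_delta c (map lam s) = 0) ->
  exists (L : finType) (l : nat * {ffun 'I_n -> int} -> L) (lam' : L -> 'I_m)
    (b : seq L -> int), (forall p, lam' (l p) = lam p) /\
    forall j u s, (forall p, p \in s -> near_pair near j u p) ->
      size s = q.+1 -> list_delta b (map l s) = c (map lam s).
Proof.
move=> N0 Ngt0 Nstep [k0 hk0] qe q0 cq near hc.
(* A finite bound exists because [c] is supported on tuples of a fixed length over a finite set. *)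
pose C := \sum_(t : q.+1.-tuple 'I_m) `|c t|.
have cC s : `|c (map lam s)| <= C.
  have [sq|/cq ->] := eqVneq (size (map lam s)) q.+1; last first.
    by rewrite normr0 sumr_ge0.
  have -> : map lam s = tcast sq (in_tuple (map lam s)) by rewrite val_tcast.
  by rewrite /C (bigD1 (tcast sq (in_tuple (map lam s)))) //= lerDl sumr_ge0.
pose w0 k : 'I_(N k.+1) := Ordinal (Ngt0 k).
have near_r k (u : {u | S u}) (w : 'I_(N k.+1)) a :
  near k.+1 u a -> near k u (round_down w a) by exact: lattice_near_round.
(* Level 0 has mesh 0, so the zero vector is near every direction and can serve as apex of the
   cone. *)
have near_z (u : {u | S u}) : near 0%N u [ffun=> 0].
  by move=> i; rewrite ffunE N0 mul0r subr0 normr0.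
have hc' j u s : (forall p, p \in s -> near_pair near j u p) ->
    list_delta (fun s => c (map lam s)) s = 0.
  by move=> hs; rewrite (list_delta_map lam c); apply: hc hs.
have scat k (u : {u | S u}) s : (k0 <= k)%N -> (forall a, a \in s -> near k.+1 u a) ->
    size s = q ->
    (2 * #|[set w : 'I_(N k.+1) | ~~ constant (map (round_down w) s)]|
       <= #|'I_(N k.+1)|)%N.
  move=> kk hs _; rewrite card_ord (leq_trans _ (hk0 k kk)) //.
  rewrite (leq_trans (leq_mul (leqnn 2) (scatter_round Ngt0 hs))) //; lia.
have [b0 [B0 hb]] := bounded_primitive w0 near_r near_z cC hc' qe q0 scat.
pose B := `|B0|%N.
pose good (s : seq (nat * {ffun 'I_n -> int})) :=
  exists j u, forall p, p \in s -> near_pair near j u p.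
have hB s : good s -> size s = q -> `|b0 s| <= B%:Z.
  move=> [j [u gs]] sq; have [/(_ sq) h _] := hb j u s gs.
  by rewrite (le_trans h) // /B; lia.
have mono k : (N k <= N k.+1)%N by case: (Nstep k) => [<-//|]; lia.
pose l := label N S q b0 B lam.
exists _, l, (fun x => x.1.2).
pose P x (s : seq (nat * {ffun 'I_n -> int})) := [/\ good s, size s = q & map l s = x].
(* The value on a list of labels is that of any good simplex carrying them; by [label_determines]
   the choice does not matter. *)
exists (fun x => b0 (xget [::] [set s | P x s]%classic)); split=> // j u s gs sq.
have [_ /(_ sq) <-] := hb j u s gs.
rewrite -(list_delta_map l); apply: eq_in_list_delta => t ts st.
have gt : good t by exists j, u => p /ts; apply: gs.
have tq : size t = q by apply: succn_inj; rewrite -st sq.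
case: xgetP => [r _ [gr rq er]|/(_ t)]; last by move=> /(_ (And3 gt tq erefl)).
exact: (label_determines mono hB q0 rq gr gt er).
Qed.
End LabelledPrimitive.

(** * Polar coordinates in hyperbolic space *)

Section RowNorm.
Local Open Scope ring_scope.

Lemma coord_le_norm (R : realType) n (v : 'rV[R]_n) j : `|v ord0 j| <= `|v|.
Proof.
rewrite [leRHS]/Num.norm /= mx_normrE; apply/bigmax_geP; right => /=.
by exists (ord0, j).
Qed.

Lemma norm_le_coord (R : realType) n (v : 'rV[R]_n) e :
  0 <= e -> (forall j, `|v ord0 j| <= e) -> `|v| <= e.
Proof.
move=> e0 h; rewrite [leLHS]/Num.norm /= mx_normrE; apply/bigmax_leP; split=> // -[i j] _ /=.
by rewrite ord1.
Qed.

End RowNorm.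

Section Hyperbolic.
Local Open Scope ring_scope.
Variable R : realType.

Definition cosh (t : R) := (expR t + expR (- t)) / 2.
Definition sinh (t : R) := (expR t - expR (- t)) / 2.

Lemma coshN t : cosh (- t) = cosh t.
Proof. by rewrite /cosh opprK addrC. Qed.

Lemma cosh2_sinh2 t : cosh t ^+ 2 - sinh t ^+ 2 = 1.
Proof. by rewrite /cosh /sinh -[RHS](expRxMexpNx_1 t); field. Qed.

Lemma coshB a b : cosh (a - b) = cosh a * cosh b - sinh a * sinh b.
Proof. by rewrite /cosh /sinh opprB !expRD; field. Qed.

Lemma coshD a b : cosh (a + b) = cosh a * cosh b + sinh a * sinh b.
Proof. by rewrite /cosh /sinh opprD !expRD; field. Qed.

Lemma cosh_abs t : cosh `|t| = cosh t.
Proof. by case: (ger0P t) => // _; rewrite coshN. Qed.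

Lemma cosh_gt0 t : 0 < cosh t.
Proof. by rewrite /cosh divr_gt0 ?addr_gt0 ?expR_gt0. Qed.

Lemma sinh_ge0 t : 0 <= t -> 0 <= sinh t.
Proof. by move=> t0; rewrite /sinh divr_ge0 // subr_ge0 ler_expR; lra. Qed.

Lemma sinh_gt0 t : 0 < t -> 0 < sinh t.
Proof. by move=> t0; rewrite /sinh divr_gt0 // subr_gt0 ltr_expR; lra. Qed.

Lemma ler_sinh : {homo sinh : a b / a <= b}.
Proof.
move=> a b ab; rewrite /sinh ler_pM2r ?invr_gt0 // lerB ?ler_expR //.
by rewrite lerN2.
Qed.

Lemma cosh0 : cosh 0 = 1.
Proof. by rewrite /cosh oppr0 expR0; field. Qed.

Lemma cosh_ge1 t : 1 <= cosh t.
Proof.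
have := cosh2_sinh2 t; have := cosh_gt0 t; have := sqr_ge0 (sinh t).
by rewrite expr2; nra.
Qed.

Lemma ltr_cosh a b : 0 <= a -> 0 <= b -> (cosh a < cosh b) = (a < b).
Proof.
have mono x y : 0 <= x -> x < y -> cosh x < cosh y.
  move=> x0 xy; rewrite -(subrK x y) coshD.
  have s0 : 0 < y - x by lra.
  have c1 : cosh 0 < cosh (y - x).
    rewrite cosh0; have := cosh2_sinh2 (y - x); have := cosh_gt0 (y - x).
    by have := sinh_gt0 s0; nra.
  have := sinh_gt0 s0; have := sinh_ge0 x0; have := cosh_gt0 x.
  by rewrite cosh0 in c1; nra.
move=> a0 b0; apply/idP/idP; last exact: mono.
apply: contraTT; rewrite -!leNgt le_eqVlt => /orP[/eqP->//|].
by move=> /(mono _ _ b0) /ltW.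
Qed.

Lemma ler_cosh a b : 0 <= a -> 0 <= b -> (cosh a <= cosh b) = (a <= b).
Proof. by move=> a0 b0; rewrite leNgt ltr_cosh // -leNgt. Qed.

Lemma arcosh_cosh t : 0 <= t -> arcosh (cosh t) = t.
Proof.
move=> t0; rewrite /arcosh -[RHS](expRK t); congr ln.
have -> : cosh t ^+ 2 - 1 = sinh t ^+ 2 by rewrite -[X in _ - X](cosh2_sinh2 t); ring.
by rewrite sqrtr_sqr ger0_norm ?sinh_ge0 // /cosh /sinh; field.
Qed.

Lemma arcosh_ge0 (q : R) : 1 <= q -> 0 <= arcosh q.
Proof.
by move=> q1; rewrite /arcosh ln_ge0 // (le_trans q1) // lerDl sqrtr_ge0.
Qed.

Lemma cosh_arcosh q : 1 <= q -> cosh (arcosh q) = q.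
Proof.
move=> q1; have s0 := sqrtr_ge0 (q ^+ 2 - 1); rewrite /cosh expRN /arcosh.
have sq : Num.sqrt (q ^+ 2 - 1) ^+ 2 = q ^+ 2 - 1.
  by rewrite sqr_sqrtr // subr_ge0 expr_ge1 //; lra.
set s := Num.sqrt _ in s0 sq *.
have p0 : 0 < q + s by lra.
rewrite lnK ?posrE //.
apply: (mulIf (x := 2 * (q + s))); first by rewrite mulf_neq0 // gt_eqF.
rewrite mulrA divfK // mulrDl mulVf ?gt_eqF //; nra.
Qed.

Lemma arcosh_lt q s : 1 <= q -> 0 <= s -> (arcosh q < s) = (q < cosh s).
Proof. by move=> q1 s0; rewrite -ltr_cosh ?arcosh_ge0 // cosh_arcosh. Qed.

Variable n : nat.

Definition dot (u v : 'rV[R]_n) := \sum_j u ord0 j * v ord0 j.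

Lemma dotC u v : dot u v = dot v u.
Proof. by apply: eq_bigr => j _; rewrite mulrC. Qed.

Lemma dotDl u v w : dot (u + v) w = dot u w + dot v w.
Proof. by rewrite -big_split; apply: eq_bigr => j _; rewrite mxE mulrDl. Qed.

Lemma dotZl a u v : dot (a *: u) v = a * dot u v.
Proof. by rewrite mulr_sumr; apply: eq_bigr => j _; rewrite mxE mulrA. Qed.

Lemma dotNl u v : dot (- u) v = - dot u v.
Proof. by rewrite -scaleN1r dotZl mulN1r. Qed.

Lemma dotB2 u v : dot (u - v) (u - v) = dot u u - 2 * dot u v + dot v v.
Proof.
rewrite dotDl dotNl (dotC u) (dotC v (u - v)) !dotDl !dotNl (dotC v u); ring.
Qed.

Lemma dot_ge0 u : 0 <= dot u u.
Proof. by apply: sumr_ge0 => j _; rewrite -expr2 sqr_ge0. Qed.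

Lemma sqr_coord_le_dot (u : 'rV[R]_n) j : u ord0 j ^+ 2 <= dot u u.
Proof.
rewrite /dot (bigD1 j) //= -expr2 lerDl; apply: sumr_ge0 => i _.
by rewrite -expr2 sqr_ge0.
Qed.

Lemma dot_le_coord (u : 'rV[R]_n) (e : R) : (forall j, `|u ord0 j| <= e) -> dot u u <= n%:R * e ^+ 2.
Proof.
move=> h; rewrite mulr_natl -[in leRHS](card_ord n) -sumr_const.
apply: ler_sum => j _; rewrite -expr2 -real_normK ?num_real //.
by rewrite lerXn2r ?nnegrE // (le_trans _ (h j)).
Qed.

Lemma dot_eq0 u : dot u u = 0 -> u = 0.
Proof.
move=> u0; apply/rowP => j; rewrite mxE.
have := sqr_coord_le_dot u j; rewrite u0 => h.
by apply/eqP; rewrite -sqrf_eq0 eq_le h sqr_ge0.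
Qed.

Definition hrow (x0 : R) (v : 'rV[R]_n) : 'rV[R]_n.+1 :=
  \row_i (if unlift ord0 i is Some j then v ord0 j else x0).

Lemma minkowskiE (x y : 'rV[R]_n.+1) :
  Defs.minkowski x y = dot (\row_j x ord0 (lift ord0 j)) (\row_j y ord0 (lift ord0 j))
                  - x ord0 ord0 * y ord0 ord0.
Proof.
rewrite /Defs.minkowski big_mkcond big_ord_recl /= add0r addrC; congr (_ - _).
by apply: eq_bigr => j _; rewrite !mxE.
Qed.

Lemma hrow0 x0 v : hrow x0 v ord0 ord0 = x0.
Proof. by rewrite mxE unlift_none. Qed.

Lemma hrow_lift x0 v : \row_j hrow x0 v ord0 (lift ord0 j) = v.
Proof. by apply/rowP => j; rewrite !mxE liftK. Qed.

Lemma hrowK (x : 'rV[R]_n.+1) : hrow (x ord0 ord0) (\row_j x ord0 (lift ord0 j)) = x.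
Proof.
by apply/rowP => i; rewrite !mxE; case: unliftP => [j ->|->]; rewrite ?mxE.
Qed.

Notation X := (hyp_space R n).
Definition height (x : X) : R := sval x ord0 ord0.
Definition space (x : X) : 'rV[R]_n := \row_j sval x ord0 (lift ord0 j).

Lemma height_space x : height x ^+ 2 = 1 + dot (space x) (space x).
Proof.
have [h _] := proj2_sig x; move: h; rewrite minkowskiE -/(height x) -/(space x); lra.
Qed.

Lemma height_ge1 x : 1 <= height x.
Proof.
have [_ h] := proj2_sig x; have := height_space x; have := dot_ge0 (space x).
by rewrite -/(height x) in h; nra.
Qed.

Lemma hyp_space_eq x y : height x = height y -> space x = space y -> x = y.
Proof.
move=> e1 e2; have e : sval x = sval y.
  by rewrite -(hrowK (sval x)) -(hrowK (sval y)) -/(height x) -/(space x) e1 e2.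
by case: x y e {e1 e2} => [x hx] [y hy] /= e; subst y; congr exist; exact: Prop_irrelevance.
Qed.

Lemma hyp_distE x y :
  hyp_dist x y = arcosh (height x * height y - dot (space x) (space y)).
Proof. by rewrite /hyp_dist minkowskiE opprB. Qed.

Lemma pt_ok (x0 : R) (v : 'rV[R]_n) : 0 < x0 -> x0 ^+ 2 = 1 + dot v v ->
  on_hyperboloid (hrow x0 v).
Proof.
by move=> x00 e; rewrite /on_hyperboloid minkowskiE hrow_lift hrow0 -expr2 e; split=> //; ring.
Qed.

Definition unit_vec := {u : 'rV[R]_n | dot u u = 1}.

Lemma polar_ok t (u : unit_vec) : (cosh t) ^+ 2 = 1 + dot (sinh t *: sval u) (sinh t *: sval u).
Proof.
by rewrite dotZl dotC dotZl (proj2_sig u) mulr1 -expr2 -[X in _ = X + _](cosh2_sinh2 t); ring.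
Qed.

Definition polar (t : R) (u : unit_vec) : X :=
  exist _ _ (pt_ok (cosh_gt0 t) (polar_ok t u)).

Lemma height_polar t u : height (polar t u) = cosh t.
Proof. exact: hrow0. Qed.

Lemma space_polar t u : space (polar t u) = sinh t *: sval u.
Proof. exact: hrow_lift. Qed.

Definition radius (x : X) := arcosh (height x).

Lemma radius_ge0 x : 0 <= radius x.
Proof. exact/arcosh_ge0/height_ge1. Qed.

Lemma hyp_dist_origin x : hyp_dist (hyp_origin R n) x = radius x.
Proof.
rewrite hyp_distE /radius; congr arcosh.
have -> : height (hyp_origin R n) = 1 by rewrite /height /= mxE eqxx.
rewrite mul1r (_ : dot _ _ = 0) ?subr0 //.
by rewrite /dot big1 // => j _; rewrite !mxE /= mul0r.
Qed.

Lemma radius_polar t u : 0 <= t -> radius (polar t u) = t.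
Proof. by move=> t0; rewrite /radius height_polar arcosh_cosh. Qed.

Definition sqdist (u v : unit_vec) := dot (sval u - sval v) (sval u - sval v).

Lemma sqdist_ge0 u v : 0 <= sqdist u v.
Proof. exact: dot_ge0. Qed.

(** The hyperbolic law of cosines, with the angle between [u] and [u'] expressed by the squared
    chord. *)
Lemma polar_gram t t' u u' :
  height (polar t u) * height (polar t' u') - dot (space (polar t u)) (space (polar t' u'))
  = cosh (t - t') + sinh t * sinh t' * sqdist u u' / 2.
Proof.
rewrite !height_polar !space_polar dotZl dotC dotZl /sqdist dotB2.
rewrite (proj2_sig u) (proj2_sig u') coshB (dotC (sval u')). lra.
Qed.

Lemma polar_dist_lt t t' u u' s : 0 <= t -> 0 <= t' -> 0 <= s ->
  (hyp_dist (polar t u) (polar t' u') < s) =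
  (cosh (t - t') + sinh t * sinh t' * sqdist u u' / 2 < cosh s).
Proof.
move=> t0 t0' s0; rewrite hyp_distE polar_gram arcosh_lt //.
rewrite (le_trans (cosh_ge1 (t - t'))) // lerDl divr_ge0 // mulr_ge0 ?sqdist_ge0 //.
by rewrite mulr_ge0 // sinh_ge0.
Qed.

Lemma polar_exists x : (0 < n)%N -> exists2 u, 0 <= radius x & x = polar (radius x) u.
Proof.
move=> n0; have h1 := height_ge1 x.
have cr : cosh (radius x) = height x by rewrite cosh_arcosh.
have hs : sinh (radius x) ^+ 2 = dot (space x) (space x).
  have := cosh2_sinh2 (radius x); rewrite cr height_space; lra.
have r0 := radius_ge0 x.
suff [u hu] : exists u : unit_vec, space x = sinh (radius x) *: sval u.
  by exists u => //; apply: hyp_space_eq; rewrite ?height_polar ?space_polar.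
(* At the origin any unit vector serves as a direction. *)
have [s0|s0] := eqVneq (sinh (radius x)) 0.
  have e1 : dot (delta_mx ord0 (Ordinal n0)) (delta_mx ord0 (Ordinal n0)) = 1.
    rewrite /dot (bigD1 (Ordinal n0)) //= big1 ?addr0.
      by rewrite mxE !eqxx mulr1.
    by move=> j /negbTE nj; rewrite mxE nj andbF mul0r.
  exists (exist (fun u => dot u u = 1) _ e1); rewrite s0 scale0r; apply: dot_eq0.
  by rewrite -hs s0 expr0n.
have e1 : dot ((sinh (radius x))^-1 *: space x) ((sinh (radius x))^-1 *: space x) = 1.
  by rewrite dotZl dotC dotZl -hs; field.
by exists (exist (fun u => dot u u = 1) _ e1); rewrite /= scalerA mulfV // scale1r.
Qed.

End Hyperbolic.

(** * Uniform continuity and oscillation of Higson functions *)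

Section UniformContinuity.
Local Open Scope classical_set_scope.
Local Open Scope ring_scope.
Variables (R : realType) (n : nat).
Notation X := (hyp_space R n).
Notation d := (@hyp_dist R n).

Let gram (x y : X) := height x * height y - dot (space x) (space y).

Let gramE x y :
  dot (space x - space y) (space x - space y) =
  2 * (gram x y - 1) + (height x - height y) ^+ 2.
Proof.
have := height_space x; have := height_space y.
rewrite dotB2 sqrrB /gram => -> ->; lra.
Qed.

Let gram_ge1 : (0 < n)%N -> forall x y, 1 <= gram x y.
Proof.
move=> n0 x y.
have [u r0 ->] := polar_exists x n0; have [v s0 ->] := polar_exists y n0.
rewrite /gram polar_gram (le_trans (cosh_ge1 (radius x - radius y))) // lerDl divr_ge0 // mulr_ge0 ?sqdist_ge0 //.
by rewrite mulr_ge0 // sinh_ge0.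
Qed.

(** By [gramE] it suffices to bound the difference of heights, which the addition formula expresses
    through the difference [s] of the radii; [cosh s] is at most the Gram value. Thus hyperbolic
    closeness gives Euclidean closeness while [height x] stays bounded. *)
Lemma space_dist_le (x y : X) (q : R) : (0 < n)%N ->
  gram x y <= q ->
  dot (space x - space y) (space x - space y) <= (q - 1) * (2 + 4 * height x ^+ 2 * q).
Proof.
move=> n0 xyq.
suff : (height x - height y) ^+ 2 <= (gram x y - 1) * (4 * height x ^+ 2 * gram x y).
  rewrite gramE; have := gram_ge1 n0 x y; have := sqr_ge0 (height x).
  set g := gram x y in xyq *; set h := _ ^+ 2; set h' := _ ^+ 2.
  move=> h0 g1 hh; have : (g - 1) * (4 * h * g) <= (q - 1) * (4 * h * q).
    have h4 : 0 <= 4 * h by lra.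
    apply: ler_pM; [lra| |lra|exact: ler_wpM2l].
    by rewrite mulr_ge0 //; lra.
  lra.
have hx := height_ge1 x.
have [u r0 ex] := polar_exists x n0; have [v s0 ey] := polar_exists y n0.
set t := radius x in r0 ex; set t' := radius y in s0 ey.
have et : height x = cosh t by rewrite ex height_polar.
have et' : height y = cosh t' by rewrite ey height_polar.
have hg : cosh (t - t') <= gram x y.
  rewrite /gram ex ey polar_gram lerDl divr_ge0 // mulr_ge0 ?sqdist_ge0 //.
  by rewrite mulr_ge0 // sinh_ge0.
set s := t - t' in hg.
have -> : height y = cosh t * cosh s - sinh t * sinh s.
  by rewrite et' -coshB /s opprB addrCA subrr addr0.
rewrite et; set g := gram x y in hg *.
have c1 := cosh_ge1 s; have c2 := cosh2_sinh2 s; have c3 := cosh2_sinh2 t.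
have c4 := cosh_gt0 t.
set a := cosh t * (cosh s - 1); set b := sinh t * sinh s.
have -> : cosh t - (cosh t * cosh s - b) = b - a by rewrite /a; ring.
have h1 : (b - a) ^+ 2 <= 2 * a ^+ 2 + 2 * b ^+ 2.
  by have := sqr_ge0 (b + a); rewrite !expr2; lra.
have h2 : b ^+ 2 <= cosh t ^+ 2 * (g ^+ 2 - 1).
  rewrite /b exprMn; apply: ler_pM; rewrite ?sqr_ge0 //; first by lra.
  have : cosh s ^+ 2 <= g ^+ 2 by rewrite lerXn2r ?nnegrE //; lra.
  lra.
have h3 : a ^+ 2 <= cosh t ^+ 2 * (g - 1) ^+ 2.
  rewrite /a exprMn ler_wpM2l ?sqr_ge0 // lerXn2r ?nnegrE //; lra.
apply: (le_trans h1); rewrite -subr_ge0.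
have -> : (g - 1) * (4 * cosh t ^+ 2 * g) - (2 * a ^+ 2 + 2 * b ^+ 2) =
  2 * (cosh t ^+ 2 * (g - 1) ^+ 2 - a ^+ 2) + 2 * (cosh t ^+ 2 * (g ^+ 2 - 1) - b ^+ 2).
  by ring.
lra.
Qed.

Let graph_ok (v : 'rV[R]_n) : on_hyperboloid (hrow (Num.sqrt (1 + dot v v)) v).
Proof.
have h : 0 < 1 + dot v v by have := dot_ge0 v; lra.
apply: pt_ok; first by rewrite sqrtr_gt0.
by rewrite sqr_sqrtr // ltW.
Qed.

Let graph v : X := exist _ _ (graph_ok v).

Let graphK x : graph (space x) = x.
Proof.
apply: hyp_space_eq; last exact: hrow_lift.
rewrite {1}/height /= hrow0 -height_space sqrtr_sqr ger0_norm //.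
by have := height_ge1 x; lra.
Qed.

Let space_graph v : space (graph v) = v.
Proof. exact: hrow_lift. Qed.

(** Heine-Cantor in the chart [graph]: pointwise continuity becomes uniform on a compact box
    containing the points of height at most [T]. *)
Lemma higson_uniform (f : X -> R) (o : X) (T e : R) : (0 < n)%N ->
  higson_function d o f -> 0 < e ->
  exists2 delta, 0 < delta &
    forall x y, height x <= T -> d x y < delta -> `|f x - f y| < e.
Proof.
move=> n0 [_ [fc _]] e0.
have e20 : 0 < e / 2 by rewrite divr_gt0.
have cts (v : 'rV[R]_n) : exists2 r, 0 < r & forall w : 'rV[R]_n, (forall j, `|v ord0 j - w ord0 j| < r) ->
    `|f (graph v) - f (graph w)| < e / 2.
  have [del del0 h] := fc (graph v) _ e20.
  pose r := Num.sqrt ((cosh del - 1) / (n%:R)).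
  have cd : 1 < cosh del by rewrite -(@cosh0 R) ltr_cosh // ltW.
  have n0' : (0 : R) < n%:R by rewrite ltr0n.
  exists r; first by rewrite sqrtr_gt0 divr_gt0 // subr_gt0.
  move=> w vw; apply: h; rewrite hyp_distE -/(gram _ _) (arcosh_lt (gram_ge1 n0 _ _) (ltW del0)).
  have := gramE (graph v) (graph w); have := sqr_ge0 (height (graph v) - height (graph w)).
  rewrite !space_graph => h1 h2.
  have h3 : dot (v - w) (v - w) <= cosh del - 1.
    have -> : cosh del - 1 = n%:R * r ^+ 2.
      rewrite /r sqr_sqrtr; first by rewrite mulrC divfK // gt_eqF.
      by rewrite divr_ge0 // subr_ge0 ltW.
    by apply: dot_le_coord => j; rewrite !mxE ltW.
  lra.
pose K := [set v : 'rV[R]_n | forall j, `[- T, T]%classic (v ord0 j)]%classic.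
have cK : compact K.
  by apply: (@rV_compact _ _ (fun=> `[- T, T]%classic)) => _; apply: segment_compact.
have /compact_near_coveringP nK := cK.
pose P (r : R) (v : 'rV[R]_n) := forall w : 'rV[R]_n, (forall j, `|v ord0 j - w ord0 j| < r) ->
    `|f (graph v) - f (graph w)| < e.
have key (v0 : 'rV[R]_n) : K v0 -> \forall v' \near v0 & r \near (0 : R)^'+, P r v'.
  move=> _; have [r r0 hr] := cts v0.
  have r20 : 0 < r / 2 by rewrite divr_gt0.
  exists (ball v0 (r / 2), [set s | s < r / 2]%classic).
    split; first exact: nbhsx_ballx.
    exact: nbhs_right_lt.
  move=> [v' s] /= [bv sr] w hw.
  have bv' j : `|v0 ord0 j - v' ord0 j| < r / 2.
    move: bv; rewrite -ball_normE /= => bv; apply: le_lt_trans bv.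
    by have := coord_le_norm (v0 - v') j; rewrite !mxE.
  rewrite -(subrKA (f (graph v0))) (le_lt_trans (ler_normD _ _)) //.
  rewrite (splitr e) ltrD //.
    by rewrite distrC hr // => j; rewrite (lt_trans (bv' j)) //; lra.
  apply: hr => j; rewrite -(subrKA (v' ord0 j)) (le_lt_trans (ler_normD _ _)) //.
  by rewrite (splitr r) ltrD // (lt_trans (hw j)).
have nr := nK _ _ P (at_right_proper_filter 0) key.
have np : \forall r \near (0 : R)^'+, 0 < r by exact: nbhs_right_gt.
have /filter_ex[r [r0 hr]] := @filterI _ _ (at_right_proper_filter 0) _ _ np nr.
(* An upper bound for the second factor in [space_dist_le] when [height x <= T] and the Gram value
   is at most 2. *)
pose T1 := 2 + 4 * (1 + T ^+ 2) * 2.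
have T10 : 0 < T1 by rewrite /T1; have := sqr_ge0 T; lra.
pose eta := Num.min 1 (r ^+ 2 / (2 * T1)).
have eta0 : 0 < eta by rewrite lt_min ltr01 divr_gt0 ?exprn_gt0 ?mulr_gt0.
have eta1 : eta <= 1 by rewrite ge_min lexx.
have eta2 : eta * T1 < r ^+ 2.
  have : eta * (2 * T1) <= r ^+ 2.
    by rewrite -ler_pdivlMr ?mulr_gt0 // ge_min lexx orbT.
  have : 0 < eta * T1 by rewrite mulr_gt0.
  lra.
have c1 : 1 <= 1 + eta by lra.
exists (arcosh (1 + eta)).
  rewrite lt_neqAle arcosh_ge0 // andbT; apply/eqP => z0.
  by have := cosh_arcosh c1; rewrite -z0 cosh0; lra.
move=> x y xT.
rewrite hyp_distE arcosh_lt ?gram_ge1 ?arcosh_ge0 // cosh_arcosh // => /ltW g1.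
have x1 := height_ge1 x.
have hT : height x ^+ 2 <= T ^+ 2 by rewrite lerXn2r ?nnegrE; lra.
rewrite -(graphK x) -(graphK y); apply: hr.
  move=> j /=; rewrite in_itv /= -ler_norml.
  have := sqr_coord_le_dot (space x) j; have := height_space x => h1 h2.
  have : `|space x ord0 j| ^+ 2 <= T ^+ 2 by rewrite real_normK ?num_real //; lra.
  by rewrite ler_sqr ?nnegrE //; lra.
move=> j.
have := sqr_coord_le_dot (space x - space y) j; rewrite !mxE -/(space x) => h1.
have h2 := space_dist_le n0 g1.
have h3 : (1 + eta - 1) * (2 + 4 * height x ^+ 2 * (1 + eta)) <= eta * T1.
  rewrite addrAC subrr add0r ler_wpM2l ?(ltW eta0) // /T1 lerD2l.
  by apply: ler_pM; rewrite ?mulr_ge0 ?sqr_ge0 //; lra.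
have : `|sval x ord0 (lift ord0 j) - sval y ord0 (lift ord0 j)| ^+ 2 < r ^+ 2.
  by rewrite real_normK ?num_real //; lra.
by rewrite ltr_sqr ?nnegrE ?(ltW r0).
Qed.

(** A uniform [delta] comes from compactness inside a large ball and from slow oscillation outside
    it. *)
Lemma higson_oscillation (f : X -> R) (e : R) : (0 < n)%N ->
  higson_function d (hyp_origin R n) f -> 0 < e ->
  (exists2 delta, 0 < delta & forall x y, d x y < delta -> `|f x - f y| <= e) /\
  (forall s, exists T, forall x y, T <= radius x -> d x y < s -> `|f x - f y| <= e).
Proof.
move=> n0 hf e0; have [_ [_ so]] := hf.
have dxx x : d x x = 0.
  rewrite hyp_distE /arcosh.
  have -> : height x * height x - dot (space x) (space x) = 1.
    by rewrite -expr2 height_space; ring.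
  by rewrite expr1n subrr sqrtr0 addr0 ln1.
have far s : exists T, forall x y, T <= radius x -> d x y < s -> `|f x - f y| <= e.
  have s0 : 0 < Num.max s 1 by rewrite lt_max ltr01 orbT.
  have [T hT] := so _ s0 _ e0; exists (T + 1) => x y Tx xy.
  apply: (hT x) => //; first by rewrite hyp_dist_origin; lra.
    by rewrite dxx.
  by rewrite lt_max xy.
split=> //; have [T hT] := far 1.
have [del del0 hd] := higson_uniform (cosh `|T|) n0 hf e0.
exists (Num.min del 1); first by rewrite lt_min del0 ltr01.
move=> x y; rewrite lt_min => /andP[xy1 xy2].
have [Tx|xT] := leP T (radius x); first exact: hT.
apply/ltW/hd => //; rewrite -(cosh_arcosh (height_ge1 x)) -/(radius x).
by rewrite ler_cosh ?radius_ge0 // (le_trans (ltW xT)) // ler_norm.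
Qed.

End UniformContinuity.

(** * Radii and meshes *)

(** The cells of level [k] occupy the radii from [inner r k] to [r k.+1]. *)
Definition inner (R : realType) (r : nat -> R) k : R :=
  (if k is k'.+1 then r k' else 0)%R.

Section Gaps.
Local Open Scope ring_scope.
Variables (R : realType) (osc : R -> R -> Prop).
Hypothesis osc_mono : forall r r' s s', r <= r' -> s' <= s -> osc r s -> osc r' s'.
Hypothesis osc_far : forall s, exists T, osc T s.
Variable D0 : R.
Hypothesis D0_gt0 : 0 < D0.
Hypothesis osc0 : osc 0 (25 * D0).

(* [(r_k, D_k)]: the radius of the k-th sphere and the gap to the next one.  The
   gap grows by 5% whenever the oscillation at that radius permits it. *)
Let step (p : R * R) : R * R :=
  (p.1 + p.2, if `[< osc (p.1 + p.2) (25 * (21 / 20 * p.2)) >] then 21 / 20 * p.2 else p.2).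
Let seqs k := iter k step (D0, D0).
Let r k := (seqs k).1.
Let D k := (seqs k).2.

Let rS k : r k.+1 = r k + D k. Proof. by []. Qed.

Let DS k : D k.+1 = 21 / 20 * D k \/ D k.+1 = D k.
Proof. by rewrite /D /seqs iterS /=; case: ifP => _; [left|right]. Qed.

Let D_gt0 k : 0 < D k.
Proof. by elim: k => // k IH; case: (DS k) => ->; rewrite ?mulr_gt0 ?divr_gt0. Qed.

Let D_le k : D k <= D k.+1.
Proof. by have := D_gt0 k; case: (DS k) => ->; lra. Qed.

Let D_le' k : D k.+1 <= 21 / 20 * D k.
Proof. by have := D_gt0 k; case: (DS k) => ->; lra. Qed.

Let D_mono : {homo D : i j / (i <= j)%N >-> i <= j}.
Proof. by apply: homo_leq => //; apply: le_trans. Qed.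

Let r_ge k : k.+1%:R * D0 <= r k.
Proof.
elim: k => [|k IH]; first by rewrite mul1r.
have := D_mono (leq0n k); rewrite -[D 0%N]/D0 rS -natr1 mulrDl mul1r => h.
exact: lerD.
Qed.

Let r_gt0 k : 0 < r k.
Proof. by apply: lt_le_trans (r_ge k); rewrite mulr_gt0. Qed.

Let osc_r k : osc (r k) (25 * D k).
Proof.
elim: k => [|k IH]; first by apply: osc_mono osc0 => //; apply: ltW.
rewrite /r /D /seqs iterS -/(seqs k) /=; case: ifPn => [/asboolP//|_].
by apply: osc_mono IH => //; rewrite -/(r k) -/(D k) lerDl ltW.
Qed.

(** If the gaps stayed below [M], the test in [step] would succeed beyond some radius, and the radii
    grow at least linearly. From then on every step would add at least [D0 / 20] to the gap. *)
Let D_unbounded M : exists k0, forall k, (k0 <= k)%N -> M <= D k.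
Proof.
suff [k hk] : exists k, M <= D k.
  by exists k => j kj; rewrite (le_trans hk) // D_mono.
apply: contrapT => /forallNP h.
have DM k : D k < M by rewrite ltNge; apply/negP; apply: h.
have [T hT] := osc_far (25 * (21 / 20 * M)).
pose k1 := Num.bound `|T / D0|.
have rT k : (k1 <= k)%N -> T <= r k.
  move=> kk; rewrite (le_trans _ (r_ge k)) // -ler_pdivrMr //.
  rewrite (le_trans (ler_norm _)) // (le_trans (ltW (archi_boundP (normr_ge0 _)))) //.
  by rewrite ler_nat leqW.
have grow k : (k1 <= k)%N -> D k.+1 = 21 / 20 * D k.
  move=> kk; rewrite /D /seqs iterS -/(seqs k) /= ifT //; apply/asboolP.
  apply: osc_mono hT; first by apply: (rT k.+1); rewrite leqW.
  by have := DM k; rewrite /D; lra.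
have lin j : j%:R * (D0 / 20) <= D (k1 + j)%N.
  elim: j => [|j IH]; first by rewrite mul0r ltW.
  rewrite addnS grow ?leq_addr // -natr1 mulrDl mul1r.
  have := D_mono (leq0n (k1 + j)); rewrite -[D 0%N]/D0; lra.
pose j := Num.bound (M / (D0 / 20)).
have M0 : 0 < M by apply: lt_trans (DM 0%N).
have D20 : 0 < D0 / 20 by rewrite divr_gt0.
have := archi_boundP (divr_ge0 (ltW M0) (ltW D20)).
rewrite ltr_pdivrMr // => h1.
by have := lin j; have := DM (k1 + j)%N; rewrite -/j in h1; lra.
Qed.

Lemma gaps_exist : exists r D : nat -> R,
  [/\ r 0%N = D0, D 0%N = D0, forall k, r k.+1 = r k + D k &
      forall k, D k <= D k.+1 <= 21 / 20 * D k] /\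
  (forall k, osc (r k) (25 * D k)) /\
  (forall M, exists k0, forall k, (k0 <= k)%N -> M <= D k).
Proof.
exists r, D; split; first by split=> // k; rewrite D_le D_le'.
by split; [exact: osc_r|exact: D_unbounded].
Qed.

End Gaps.

(** * Lattice meshes adapted to the radii *)

Section GapBound.
Local Open Scope ring_scope.

Lemma sinh_le_exp (R : realType) (y : R) : sinh y <= expR y / 2.
Proof. by rewrite /sinh ler_pM2r ?invr_gt0 // gerBl expR_ge0. Qed.

(** The product of the two [sinh] is at most [expR (2 * rk + x) / 4], while [q] is of order
    [expR (20 * x - 2 * rk)]. So the angular term is at most [8 * c / K ^+ 2 * expR (21 * x)], which
    fits between [cosh x] and [cosh (22 * x)]. *)
Lemma polar_gap_bound (R : realType) (c K kap x rk t M q : R) :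
  0 < x -> 0 <= t -> 0 < rk -> rk - x <= t -> 1 <= K -> 8 * c / K ^+ 2 < kap ->
  kap * expR (21 * x) <= cosh (22 * x) - cosh x ->
  t <= rk + x -> K * expR (rk - 10 * x) < 2 * M -> 0 <= q -> M ^+ 2 * q <= 16 * c ->
  cosh (t - rk) + sinh t * sinh rk * q / 2 < cosh (22 * x).
Proof.
move=> x0 t0 rk0 lo K1 K2 h5 hi b2 q0 hq.
have h1 : cosh (t - rk) <= cosh x.
  rewrite -(cosh_abs (t - rk)) ler_cosh ?(ltW x0) // ler_norml.
  by clear -lo hi; apply/andP; split; lra.
have h2 : sinh t * sinh rk <= expR (2 * rk + x) / 4.
  have -> : expR (2 * rk + x) / 4 = (expR (rk + x) / 2) * (expR rk / 2).
    have -> : 2 * rk + x = (rk + x) + rk by ring.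
    by rewrite expRD; field.
  apply: ler_pM; rewrite ?sinh_ge0 ?(ltW rk0) ?sinh_le_exp //.
  by rewrite (le_trans (sinh_le_exp t)) // ler_pM2r ?invr_gt0 // ler_expR.
set T := K * _ in b2.
have tp : 0 < T by rewrite mulr_gt0 ?expR_gt0 //; clear -K1; lra.
have h3 : T ^+ 2 * q <= 64 * c.
  apply: (@le_trans _ _ ((2 * M) ^+ 2 * q)).
    by rewrite ler_wpM2r // lerXn2r ?nnegrE ?(ltW tp) ?(ltW b2) // (le_trans (ltW tp)) ?ltW.
  by rewrite exprMn; clear -hq; lra.
have KK : 0 < K ^+ 2 by rewrite exprn_gt0 //; clear -K1; lra.
have h4 : expR (2 * rk + x) * q <= 64 * c / K ^+ 2 * expR (21 * x).
  have e : expR (2 * rk + x) * K ^+ 2 = T ^+ 2 * expR (21 * x).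
    rewrite /T exprMn -expRM_natl [LHS]mulrC -[RHS]mulrA -expRD; congr (_ * expR _).
    by ring.
  rewrite -(ler_pM2r KK) mulrAC e mulrAC.
  have -> : 64 * c / K ^+ 2 * expR (21 * x) * K ^+ 2 = 64 * c * expR (21 * x).
    by rewrite mulrAC divfK // gt_eqF.
  by rewrite ler_wpM2r ?expR_ge0.
have h6 : sinh t * sinh rk * q <= expR (2 * rk + x) / 4 * q by rewrite ler_wpM2r.
have h7 : 8 * c / K ^+ 2 * expR (21 * x) < kap * expR (21 * x).
  by rewrite ltr_pM2r ?expR_gt0.
clear -h1 h4 h5 h6 h7; lra.
Qed.

End GapBound.

Section Scales.
Local Open Scope ring_scope.
Variables (R : realType) (n : nat) (osc : R -> R -> Prop) (D0 : R) (r D : nat -> R).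
Hypothesis D0_gt0 : 0 < D0.
Hypothesis osc0 : osc 0 (25 * D0).
Hypothesis r0 : r 0%N = D0.
Hypothesis D00 : D 0%N = D0.
Hypothesis rS : forall k, r k.+1 = r k + D k.
Hypothesis D_step : forall k, D k <= D k.+1 <= 21 / 20 * D k.
Hypothesis osc_r : forall k, osc (r k) (25 * D k).
Hypothesis D_unbounded : forall M, exists k0, forall k, (k0 <= k)%N -> M <= D k.

Let D_le k : D k <= D k.+1. Proof. by case/andP: (D_step k). Qed.
Let D_le' k : D k.+1 <= 21 / 20 * D k. Proof. by case/andP: (D_step k). Qed.

Let D_gt0 k : 0 < D k.
Proof. by elim: k => [|k IH]; [rewrite D00|exact: lt_le_trans (D_le k)]. Qed.

Let D_mono : {homo D : i j / (i <= j)%N >-> i <= j}.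
Proof. by apply: homo_leq => //; apply: le_trans. Qed.

Let D_ge k : D0 <= D k.
Proof. by rewrite -D00 D_mono. Qed.

Let r_ge k : k.+1%:R * D0 <= r k.
Proof.
elim: k => [|k IH]; first by rewrite mul1r r0.
by rewrite rS -natr1 mulrDl mul1r lerD.
Qed.

Let r_gt0 k : 0 < r k.
Proof. by apply: lt_le_trans (r_ge k); rewrite mulr_gt0. Qed.

Let kappa : R := (1 - expR (- (21 * D0))) * (expR D0 - 1) / 2.

Let kappa_gt0 : 0 < kappa.
Proof.
rewrite divr_gt0 // mulr_gt0 // subr_gt0 ?expR_lt1 ?expR_gt1 //.
by rewrite oppr_lt0 mulr_gt0.
Qed.

Let cosh_gap x : D0 <= x -> kappa * expR (21 * x) <= cosh (22 * x) - cosh x.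
Proof.
move=> x0; have xp : 0 < x by exact: lt_le_trans x0.
have -> : cosh (22 * x) - cosh x =
   (1 - expR (- (21 * x))) * (expR x - expR (- (22 * x))) / 2 * expR (21 * x).
  have e1 : expR (22 * x) = expR (21 * x) * expR x by rewrite -expRD; congr expR; ring.
  have e2 : expR (- x) = expR (21 * x) * expR (- (22 * x)).
    by rewrite -expRD; congr expR; ring.
  have e3 := expRxMexpNx_1 (21 * x).
  rewrite /cosh e1 e2.
  have -> : expR (- (22 * x)) = expR (- (21 * x)) * expR (- x).
    by rewrite -expRD; congr expR; ring.
  have e4 := expRxMexpNx_1 x.
  move: e3 e4; set a := expR (21 * x); set b := expR (- (21 * x)).
  set c := expR x; set d := expR (- x) => ab cd.
  have : (a * c + b * d - (c + a * (b * d))) - (1 - b) * (c - b * d) * a =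
    (a * b - 1) * (c - b * d) by ring.
  rewrite ab; lra.
rewrite ler_pM2r ?expR_gt0 // /kappa ler_pM2r ?invr_gt0 //.
apply: ler_pM.
- by rewrite subr_ge0 expR_le1 oppr_le0 mulr_ge0 // ltW.
- by rewrite subr_ge0 ltW // expR_gt1.
- by rewrite lerB // ler_expR lerN2; lra.
- by rewrite lerB ?ler_expR // expR_le1 oppr_le0 mulr_ge0 // ltW.
Qed.

(** The first two summands serve [K_gt]; the exponential makes every [target] at least 1. *)
Let K : R := 8 * n%:R / kappa + 1 + expR (10 * D0).

Let K_gt : 1 <= K /\ 8 * n%:R / K ^+ 2 < kappa.
Proof.
have h1 := expR_ge0 (10 * D0).
have h2 : 0 <= 8 * n%:R / kappa by apply: divr_ge0; [exact: mulr_ge0|exact: ltW].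
have K1 : 1 <= K by rewrite /K; lra.
split=> //; rewrite ltr_pdivrMr ?exprn_gt0 //; last by lra.
have h3 : 8 * n%:R < kappa * K.
  rewrite (mulrC kappa) -ltr_pdivrMr // /K; lra.
by rewrite (lt_le_trans h3) // ler_pM2l // expr2 ler_peMr //; lra.
Qed.

Let target k := K * expR (r k - 10 * D k).

Let target_ge1 k : 1 <= target k.
Proof.
have [K1 _] := K_gt.
have h : - (9 * D0) <= r k - 10 * D k.
  elim: k => [|k IH]; first by rewrite r0 D00; lra.
  by rewrite rS; have := D_le' k; have := D_gt0 k; lra.
have : expR (- (10 * D0)) <= expR (r k - 10 * D k) by rewrite ler_expR; move: h D0_gt0; lra.
have e1 := expRxMexpNx_1 (10 * D0).
have h2 : 0 <= 8 * n%:R / kappa by apply: divr_ge0; [exact: mulr_ge0|exact: ltW].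
have h3 : expR (10 * D0) <= K by rewrite /K; lra.
move=> h4; rewrite -e1 /target; apply: ler_pM => //; exact: expR_ge0.
Qed.

(** The gaps grow by at most 5%, so [10 * D k] grows by at most [D k / 2] while the radius grows by
    [D k]. *)
Let target_growth k : expR (D k / 2) * target k <= target k.+1.
Proof.
have [K1 _] := K_gt.
rewrite /target mulrCA ler_pM2l; last by lra.
rewrite -expRD ler_expR rS; have := D_le' k; have := D_gt0 k; lra.
Qed.

(** Powers of two make consecutive meshes equal or at least doubled. The value 0 at level 0 makes
    that level blind to directions. *)
Let N k := if k is k'.+1 then (2 ^ trunc_log 2 (Num.trunc (target k)))%N else 0%N.

Let N_bounds k : (N k.+1)%:R <= target k.+1 < 2 * (N k.+1)%:R.
Proof.
rewrite /N; set x := target k.+1; set m := Num.trunc x.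
have x0 : 0 <= x by rewrite (le_trans _ (target_ge1 _)).
have /andP[m1 m2] := truncn_itv x0.
have m0 : (0 < m)%N by rewrite truncn_gt0 target_ge1.
have /andP[b1 b2] := trunc_log_bounds (isT : (1 < 2)%N) m0.
apply/andP; split; first by rewrite (le_trans _ m1) // ler_nat.
by rewrite (lt_le_trans m2) // -natrM ler_nat -expnS.
Qed.

(** The upper bound on the mesh serves the slow oscillation of the bumps, the growth conditions
    serve the random rounding, and the last clause controls the oscillation over a cell. *)
Lemma mesh_exists : exists N : nat -> nat,
  [/\ exists2 C, 0 < C & forall k, (N k.+1)%:R <= C * expR (- D k) * sinh (r k),
      N 0%N = 0%N, forall k, (0 < N k.+1)%N &
      forall k, N k = N k.+1 \/ (2 * N k <= N k.+1)%N] /\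
  (exists k0, forall k, (k0 <= k)%N -> (8 * n * N k <= N k.+1)%N) /\
  (forall k t q, inner r k <= t -> t <= r k.+1 -> 0 <= q -> q <= 4 ->
    (N k)%:R ^+ 2 * q <= 16 * n%:R ->
    exists2 s, 0 <= s & osc (inner r k) s /\
      cosh (t - r k) + sinh t * sinh (r k) * q / 2 < cosh s).
Proof.
have [K1 K2] := K_gt.
exists N; split; [split=> //|split].
- pose th := (1 - expR (- (2 * D0))) / 2.
  have th0 : 0 < th.
    by rewrite divr_gt0 // subr_gt0 expR_lt1 oppr_lt0 mulr_gt0.
  exists (K / th); first by rewrite divr_gt0 //; lra.
  move=> k; have /andP[h _] := N_bounds k; apply: (le_trans h).
  have hs : th * expR (r k) <= sinh (r k).
    have e : expR (- r k) = expR (r k) * expR (- (2 * r k)).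
      by rewrite -expRD; congr expR; ring.
    rewrite /sinh e /th.
    have : expR (- (2 * r k)) <= expR (- (2 * D0)).
      rewrite ler_expR lerN2 ler_pM2l // (le_trans _ (r_ge k)) //.
      by rewrite ler_peMl ?(ltW D0_gt0) // ler1n.
    have := expR_gt0 (r k); set a := expR (r k); set b := expR _; set c := expR _.
    by move=> a0 bc; have := ler_wpM2l (ltW a0) bc; lra.
  apply: (@le_trans _ _ (K / th * expR (- D k) * (th * expR (r k)))); last first.
    rewrite ler_wpM2l // mulr_ge0 ?expR_ge0 // divr_ge0 ?(ltW th0) //; lra.
  have -> : K / th * expR (- D k) * (th * expR (r k)) = K * expR (r k - D k).
    by rewrite [r k - _]addrC expRD; field; rewrite gt_eqF.
  rewrite /target ler_pM2l; last by lra.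
  by rewrite ler_expR rS; have := D_le k; have := D_gt0 k; lra.
- by move=> k; rewrite /N expn_gt0.
- move=> [|k]; first by right.
  have le : (trunc_log 2 (Num.trunc (target k.+1)) <= trunc_log 2 (Num.trunc (target k.+2)))%N.
    apply/leq_trunc_log/le_truncn; apply: le_trans (target_growth _).
    have : 1 <= expR (D k.+1 / 2) by rewrite -expR0 ler_expR divr_ge0 // ltW.
    by move=> h; rewrite ler_peMl // (le_trans _ (target_ge1 _)).
  rewrite /N; move: le; rewrite leq_eqVlt => /orP[/eqP->|lt]; first by left.
  by right; rewrite -expnS leq_exp2l.
(* From [D >= 32 * n] follows [expR (D / 2) >= 16 * n]; rounding the target down to a power of two
   loses a factor below 2. *)
- have [k0 hk0] := D_unbounded (32 * n%:R).
  exists k0 => -[|k] kk; first by rewrite muln0.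
  have Dk := hk0 _ kk.
  have e1 : 16 * n%:R <= expR (D k.+1 / 2).
    by rewrite (le_trans _ (expR_ge1Dx _)) //; lra.
  have /andP[_ b2] := N_bounds k.+1; have /andP[b1 _] := N_bounds k.
  have g := target_growth k.+1.
  have : 16 * n%:R * (N k.+1)%:R <= expR (D k.+1 / 2) * target k.+1.
    by apply: ler_pM; rewrite ?mulr_ge0.
  rewrite -(ler_nat R) !natrM; lra.
move=> [|k] t q /= lo hi q0 q4 hq.
  exists (25 * D0); first by rewrite mulr_ge0 // ltW.
  split=> //.
  (* At level 0 the directions are unconstrained. The path through the origin has length at most
     [3 * D0]. *)
  apply: (@le_lt_trans _ _ (cosh (t + r 0))).
    rewrite coshB coshD.
    have : sinh t * sinh (r 0) * q <= sinh t * sinh (r 0) * 4.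
      by rewrite ler_wpM2l // mulr_ge0 // sinh_ge0 // ltW.
    lra.
  rewrite rS r0 D00 in hi; rewrite r0 ltr_cosh //; last by rewrite mulr_ge0 // ltW.
    by move: D0_gt0 hi; lra.
  by rewrite addr_ge0 // ltW.
exists (25 * D k); first by rewrite mulr_ge0 // ltW.
split; first exact: osc_r.
have [K1' K2'] := K_gt.
have t0 : 0 < t by apply: lt_le_trans lo.
have /andP[_ b2] := N_bounds k.
(* Here [22 * (21 / 20) < 25], so the oscillation estimate at the previous radius still applies. *)
apply: (@lt_le_trans _ _ (cosh (22 * D k.+1))).
  apply: (polar_gap_bound _ _ _ _ K1' K2' (cosh_gap (D_ge k.+1)) _ b2 q0 hq) => //.
    exact: ltW.
    by apply: le_trans lo; rewrite lerBlDr rS lerD2l D_le.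
  by rewrite -rS.
have := D_le' k; have := D_gt0 k; have := D_gt0 k.+1.
move: (D k) (D k.+1) => a b b0 a0 ab.
by rewrite ler_cosh ?mulr_ge0 ?ltW //; lra.
Qed.

End Scales.

(** * Pointwise convergence *)

Section PointwiseTopology.
Local Open Scope ring_scope.
Local Open Scope classical_set_scope.
Variables (R : realType) (I : Type).

Definition ptws_ball (fs : seq I) (e : R) (p : {ptws I -> R}) : set {ptws I -> R} :=
  [set p' : {ptws I -> R} | forall f, List.In f fs -> `|p f - p' f| < e].

Lemma ptws_eval_continuous (f : I) : continuous (fun p : {ptws I -> R} => p f).
Proof. exact: (@proj_continuous {classic I} (fun=> R) f). Qed.

Lemma ptws_ball_nbhs fs e p : 0 < e -> nbhs p (ptws_ball fs e p).
Proof.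
move=> e0; elim: fs => [|f fs IH]; first by apply: filterE => p' f [].

have nf : nbhs p [set p' : {ptws I -> R} | `|p f - p' f| < e].
  by have := @ptws_eval_continuous f p _ (nbhsx_ballx (p f) e e0).
by apply: filterS2 nf IH => p' h1 h2 g /= [<-//|/h2].
Qed.

Lemma nbhs_ptws_ball p (V : set {ptws I -> R}) : nbhs p V ->
  exists fs e, 0 < e /\ ptws_ball fs e p `<=` V.
Proof.
pose G := filter_from [set fe : seq I * R | 0 < fe.2] (fun fe => ptws_ball fe.1 fe.2 p).
have FG : Filter G.
  apply: filter_from_filter; first by exists ([::], 1) => /=.
  move=> [fs e] [fs' e'] /= e0 e'0; exists (fs ++ fs', Num.min e e') => /=.
    by rewrite lt_min e0.
  move=> p' h; split=> f ff; have := h f; rewrite lt_min => h'.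
    by have /andP[] := h' (List.in_or_app _ _ _ (or_introl ff)).
  by have /andP[] := h' (List.in_or_app _ _ _ (or_intror ff)).
have Gp : G --> p.
  apply/cvg_sup => i U [V'] [[W] oW <-] WfN WU.
  have /nbhs_ballP[e /= e0 eW] : nbhs (p i) W by exact: open_nbhs_nbhs.
  exists ([:: i], e) => //= p' h; apply: WU; apply: eW; apply: h; by left.
by move=> /Gp [[fs e] /= e0 h]; exists fs, e.
Qed.

Lemma ptws_compact (A : set {ptws I -> R}) :
  closed A -> (forall f, exists M, forall p, A p -> `|p f| <= M) -> compact A.
Proof.
move=> cA hM.
pose M f := sval (cid (hM f)).
have cK : compact [set p : {ptws I -> R} | forall f, `[- M f, M f]%classic (p f)].
  apply: (@tychonoff {classic I} (fun=> R) (fun f => `[- M f, M f]%classic)) => f.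
  exact: segment_compact.
apply: subclosed_compact cA cK _ => p Ap f /=.
by rewrite in_itv /= -ler_norml; exact: svalP (cid (hM f)) p Ap.
Qed.

(** A Lebesgue number for the cover. The balls around [p] are taken with twice the radius, so that a
    finite subcover by the smaller balls leaves room for a uniform [e]. *)
Lemma ptws_lebesgue (A : set {ptws I -> R}) (J : Type) (U : J -> set {ptws I -> R}) :
  compact A -> open_cover A U ->
  exists fs e m (iota : 'I_m -> J), 0 < e /\
    forall p, A p -> exists j, ptws_ball fs e p `<=` U (iota j).
Proof.
move=> cA [oU AU].
have hp p : A p -> exists t : J * (seq I * R),
    0 < t.2.2 /\ ptws_ball t.2.1 (2 * t.2.2) p `<=` U t.1.
  move=> Ap; have [j _ Uj] := AU _ Ap.
  have [fs [e [e0 h]]] := nbhs_ptws_ball (open_nbhs_nbhs (conj (oU j) Uj)).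
  by exists (j, (fs, e / 2)) => /=; rewrite divr_gt0 // mulrCA mulfV // mulr1.
have [->|/set0P [p0 Ap0]] := eqVneq A set0.
  by exists [::], 1, 0%N, (fun i : 'I_0 => False_rect _ (notF (ltn_ord i))).
(* Points outside [A] receive the data of [p0], which keeps all radii positive in the minimum [e]
   below. *)
pose t p := if pselect (A p) is left Ap then sval (cid (hp _ Ap)) else sval (cid (hp _ Ap0)).
have ht p : A p -> 0 < (t p).2.2 /\ ptws_ball (t p).2.1 (2 * (t p).2.2) p `<=` U (t p).1.
  by move=> Ap; rewrite /t; case: pselect => // Ap'; exact: (svalP (cid (hp _ Ap'))).
(* The filter of finite sets ordered by inclusion turns the near-covering form of compactness into a
   finite subcover. *)
pose F := filter_from setT (fun s : seq {classic {ptws I -> R}} =>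
  [set s' : seq {classic {ptws I -> R}} | {subset s <= s'}]).
have FF : Filter F.
  apply: filter_from_filter; first by exists [::].
  move=> s s' _ _; exists (s ++ s') => // r rs.
  by split=> p ps; apply: rs; rewrite mem_cat ps ?orbT.
pose P (s : seq {classic {ptws I -> R}}) p :=
  exists2 q : {classic {ptws I -> R}}, q \in s & A q /\ ptws_ball (t q).2.1 (t q).2.2 q p.
have [s _ /(_ s (fun _ => id)) /= cov] : \near F, A `<=` P F.
  have /compact_near_coveringP := cA; apply => p Ap.
  exists (ptws_ball (t p).2.1 (t p).2.2 p,
          [set s : seq {classic {ptws I -> R}} | (p : {classic {ptws I -> R}}) \in s]).
    split; first by apply: ptws_ball_nbhs; case: (ht p Ap).
    by exists [:: p] => // s' ps; apply: ps; rewrite inE.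
  by move=> [p' s'] /= [pp' ps']; exists p.
pose fs := flatten [seq (t p).2.1 | p <- s].
pose e := \big[Num.min/1]_(p <- s) (t p).2.2.
have t0 p : 0 < (t p).2.2.
  rewrite /t; case: pselect => [Ap|_]; first by case: (svalP (cid (hp _ Ap))).
  by case: (svalP (cid (hp _ Ap0))).
exists fs, e, (size s), (fun i => (t (nth p0 s i)).1); split.
  by rewrite /e; elim/big_ind: _ => // x y x0 y0; rewrite lt_min x0.
move=> p Ap; have [q qs [Aq hq]] := cov _ Ap.
have iq : (index q s < size s)%N by rewrite index_mem.
exists (Ordinal iq); rewrite /= nth_index //.
have [e0 hU] := ht q Aq.
move=> p' h; apply: hU => f ff.
have eq : e <= (t q).2.2.
  rewrite /e; elim: (s) qs => //= a s' IH; rewrite inE big_cons => /orP[/eqP<-|/IH h'].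
    by rewrite ge_min lexx.
  by rewrite ge_min h' orbT.
have ffs : List.In f fs.
  rewrite /fs; elim: (s) qs => //= a s' IH; rewrite inE => /orP[/eqP<-|/IH h'].
    by apply: List.in_or_app; left.
  by apply: List.in_or_app; right.
rewrite -(subrKA (p f)) (le_lt_trans (ler_normD _ _)) // mulrDl mul1r ltrD //.
  exact: hq.
exact: lt_le_trans (h _ ffs) eq.
Qed.

End PointwiseTopology.

(** * Slowly oscillating bumps *)

Section Bumps.
Local Open Scope ring_scope.

Lemma norm_le_dot (R : realType) n (v : 'rV[R]_n) : `|v| <= Num.sqrt (dot v v).
Proof.
apply: norm_le_coord => [|j]; first exact: sqrtr_ge0.
by rewrite -sqrtr_sqr ler_sqrt ?dot_ge0 // sqr_coord_le_dot.
Qed.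

Lemma ler_dist_min (R : realType) (a b a' b' e : R) : `|a - a'| <= e -> `|b - b'| <= e ->
  `|Num.min a b - Num.min a' b'| <= e.
Proof.
rewrite !ler_norml => /andP[? ?] /andP[? ?].
by case: (leP a b) => ?; case: (leP a' b') => ?; apply/andP; split; lra.
Qed.

Lemma ler_dist_max (R : realType) (a b a' b' e : R) : `|a - a'| <= e -> `|b - b'| <= e ->
  `|Num.max a b - Num.max a' b'| <= e.
Proof.
rewrite !ler_norml => /andP[? ?] /andP[? ?].
by case: (leP a b) => ?; case: (leP a' b') => ?; apply/andP; split; lra.
Qed.

Lemma ler_dist_between (R : realType) (s t a b e : R) : `|s - t| <= e -> s <= 0 ->
  0 <= a -> a <= s -> 0 <= b -> b <= t -> `|a - b| <= e.
Proof. by rewrite !ler_norml => /andP[? ?] ? ? ? ? ?; apply/andP; split; lra. Qed.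

Lemma ler_dist_sym (R : realType) (a b e : R) : a <= b + e -> b <= a + e -> `|a - b| <= e.
Proof. by move=> ? ?; rewrite ler_norml; apply/andP; split; lra. Qed.

Lemma ler_dist_half (R : realType) (a b c e : R) :
  `|a - b| <= e / 2 -> `|a - c| <= e / 2 -> `|b - c| <= e.
Proof. by rewrite !ler_norml => /andP[? ?] /andP[? ?]; apply/andP; split; lra. Qed.

Lemma le_gap (R : realType) (a p c : R) : a + p / 2 < c -> 1 <= a -> p <= 2 * (c - 1).
Proof. by lra. Qed.

Variables (R : realType) (n : nat) (r D : nat -> R) (N : nat -> nat).
Hypothesis n_gt0 : (0 < n)%N.
Hypothesis r0_gt0 : 0 < r 0%N.
Hypothesis rS : forall k, r k.+1 = r k + D k.
Hypothesis D_gt0 : forall k, 0 < D k.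
Hypothesis D_mono : {homo D : i j / (i <= j)%N >-> i <= j}.
Hypothesis D_unbounded : forall M, exists k0, forall k, (k0 <= k)%N -> M <= D k.
Variable C : R.
Hypothesis C_gt0 : 0 < C.
Hypothesis mesh_le : forall k, (N k.+1)%:R <= C * expR (- D k) * sinh (r k).
Hypothesis N0 : N 0%N = 0%N.

Notation X := (hyp_space R n).
Notation Z := {ffun 'I_n -> int}.
Notation d := (@hyp_dist R n).

Let r_mono : {homo r : i j / (i <= j)%N >-> i <= j}.
Proof. by apply: homo_leq => // [i j k|k]; [exact: le_trans|rewrite rS lerDl ltW]. Qed.

Let r_gt0 k : 0 < r k.
Proof. exact: lt_le_trans (r_mono (leq0n k)). Qed.

Let r_lt i j : r i < r j -> (i < j)%N.
Proof. by move=> h; rewrite ltnNge; apply/negP => /r_mono; rewrite leNgt h. Qed.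

Let r_unbounded t : exists k, t < r k.
Proof.
have [k0 hk] := D_unbounded (`|t| + 1).
exists k0.+1; rewrite rS; have := hk _ (leqnn k0); have := r_gt0 k0.
by have := ler_norm t; lra.
Qed.

Lemma level_of t : 0 <= t -> exists j, (t < r j.+1) /\ (j = 0%N \/ r j <= t).
Proof.
move=> t0; have [k hk] := r_unbounded t.
have ex : exists k, t < r k by exists k.
case: (ex_minnP ex) => -[|j] hj mj.
  by exists 0%N; split; [rewrite (lt_le_trans hj) // r_mono|left].
exists j; split=> //; case: j hj mj => [|j] hj mj; first by left.
by right; rewrite leNgt; apply/negP => /mj; rewrite ltnn.
Qed.

(** A peak at [r k] with slopes [1 / D k.-1] and [1 / D k], which tend to 0; [tent 0] is constantly
    1 up to [r 0]. *)
Definition tent k t : R :=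
  Num.max 0 (Num.min (if k is k'.+1 then 1 + (t - r k) / D k' else 1)
                     (1 - (t - r k) / D k)).

Lemma tent_le1 k t : tent k t <= 1.
Proof.
rewrite /tent ge_max ler01 /= ge_min.
have [tr|/ltW tr] := leP t (r k); last first.
  by rewrite gerBl divr_ge0 ?orbT // ?subr_ge0 // ltW.
by case: k tr => [|k] tr; rewrite ?lexx // gerDl ler_pdivrMr // mul0r subr_le0 tr.
Qed.

Lemma tent_supp k t : 0 <= t -> 0 < tent k t -> inner r k <= t <= r k.+1.
Proof.
move=> t0; rewrite /tent lt_max ltxx /= lt_min => /andP[h1 h2].
apply/andP; split.
  case: k h1 {h2} => [//|k]; rewrite rS => h1.
  have : - 1 < (t - (r k + D k)) / D k by lra.
  rewrite ltr_pdivlMr // => h; rewrite /inner; lra.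
have : (t - r k) / D k < 1 by lra.
by rewrite ltr_pdivrMr // rS => h; lra.
Qed.

(** Between [r j] and [r j.+1] the two relevant tents add up to 1, so one of them is at least
    1/2. *)
Lemma tent_cover t : 0 <= t -> exists k, 1 / 2 <= tent k t.
Proof.
move=> t0; have [j [h1 h2]] := level_of t0.
have Dj := D_gt0 j; set th := (t - r j) / D j.
have e : th * D j = t - r j by rewrite divfK // gt_eqF.
have th1 : th < 1 by rewrite ltr_pdivrMr // mul1r; move: h1; rewrite rS; lra.
have [thh|/ltW thh] := leP th (1 / 2).
  exists j; rewrite /tent le_max; apply/orP; right.
  rewrite le_min -/th; apply/andP; split; last by lra.
  case: j h2 {h1 Dj th e th1 thh} => [_|j [//|h2]]; first by lra.
  have : 0 <= (t - r j.+1) / D j by rewrite divr_ge0 ?subr_ge0 // ltW.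
  lra.
exists j.+1; rewrite /tent le_max; apply/orP; right.
rewrite le_min; apply/andP; split.
  have -> : 1 + (t - r j.+1) / D j = th by rewrite /th rS; field; rewrite gt_eqF.
  by lra.
have : (t - r j.+1) / D j.+1 <= 0 by rewrite ler_pdivrMr // mul0r subr_le0 ltW.
lra.
Qed.

Lemma tent_lip k t t' : `|tent k t - tent k t'| <= `|t - t'| / D k.-1.
Proof.
have e0 : 0 <= `|t - t'| / D k.-1 by rewrite divr_ge0 // ltW.
apply: ler_dist_max; first by rewrite subrr normr0.
have lip j : (k.-1 <= j)%N -> `|(t - r k) / D j - (t' - r k) / D j| <= `|t - t'| / D k.-1.
  move=> kj; rewrite -mulrBl opprB addrA subrK normrM normfV (gtr0_norm (D_gt0 j)).
  by rewrite ler_wpM2l // lef_pV2 ?posrE // D_mono.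
apply: ler_dist_min.
  case: k e0 lip => [|k] e0 lip; first by rewrite subrr normr0.
  by rewrite opprD addrACA subrr add0r; apply: lip.
by rewrite opprB addrC addrA subrK distrC; apply: lip; rewrite leq_pred.
Qed.

Lemma direction_exists (x : X) : exists u, x = polar (radius x) u.
Proof. by have [u _ h] := polar_exists x n_gt0; exists u. Qed.

(** The choice at the origin is arbitrary but harmless for the bumps: below [r 0] only those of
    level 0 can be positive, and they ignore directions since [N 0] vanishes. *)
Definition direction (x : X) : unit_vec R n := sval (cid (direction_exists x)).

Lemma directionE x : x = polar (radius x) (direction x).
Proof. exact: svalP (cid (direction_exists x)). Qed.

Definition lattice_row (a : Z) : 'rV[R]_n := \row_i (a i)%:~R.

(** The norm is the maximum norm, so positivity of the second factor implies [lattice_near], whose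
    tolerance is 2. *)
Definition bump (p : nat * Z) (x : X) : R :=
  Num.min (tent p.1 (radius x))
    (Num.max 0 (2 - `|(N p.1)%:R *: sval (direction x) - lattice_row p.2|)).

Lemma bump_ge0 p x : 0 <= bump p x.
Proof. by rewrite le_min !le_max !lexx. Qed.

Lemma bump_le_tent p x : bump p x <= tent p.1 (radius x).
Proof. by rewrite ge_min lexx. Qed.

Lemma bump_supp p x : 0 < bump p x ->
  lattice_near N p.1 (sval (direction x)) p.2 /\
  inner r p.1 <= radius x <= r p.1.+1.
Proof.
rewrite lt_min => /andP[h1]; rewrite lt_max ltxx /= => h2.
split; last exact: tent_supp (radius_ge0 x) h1.
move=> i; rewrite distrC.
have := coord_le_norm ((N p.1)%:R *: sval (direction x) - lattice_row p.2) i.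
by rewrite !mxE; lra.
Qed.

Lemma bump_cover x : exists p, 1 / 2 <= bump p x.
Proof.
have [k hk] := tent_cover (radius_ge0 x).
exists (k, [ffun i => Num.floor ((N k)%:R * sval (direction x) ord0 i)]).
rewrite /bump le_min hk /= le_max; apply/orP; right.
suff : `|(N k)%:R *: sval (direction x) -
  lattice_row [ffun i => Num.floor ((N k)%:R * sval (direction x) ord0 i)]| <= 1.
  by lra.
apply: norm_le_coord => // i; rewrite !mxE ffunE.
have := floor_itv ((N k)%:R * sval (direction x) ord0 i).
rewrite rmorphD /= => /andP[h1 h2]; rewrite ger0_norm; lra.
Qed.

(** The directions need comparison only when both points lie beyond [r k]. If one is below, its tent
    vanishes and the other bump is bounded by the variation of the tent. *)
Lemma bump_dist p x y e : 0 <= e ->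
  `|radius x - radius y| / D p.1.-1 <= e ->
  (forall k, p.1 = k.+1 -> r k <= radius x -> r k <= radius y ->
    (N p.1)%:R * `|sval (direction x) - sval (direction y)| <= e) ->
  `|bump p x - bump p y| <= e.
Proof.
move=> e0 h1 h2.
have ht := le_trans (tent_lip p.1 (radius x) (radius y)) h1.
have hn : (N p.1)%:R * `|sval (direction x) - sval (direction y)| <= e ->
    `|bump p x - bump p y| <= e.
  move=> h; apply: ler_dist_min => //; apply: ler_dist_max; first by rewrite subrr normr0.
  rewrite opprD addrACA subrr add0r opprK addrC (le_trans (ler_dist_dist _ _)) //.
  rewrite opprB addrA subrK -scalerBr normrZ normr_nat distrC //.
case ek : p.1 => [|k]; first by apply: hn; rewrite ek N0 mul0r.
have low z w : `|tent p.1 (radius z) - tent p.1 (radius w)| <= e ->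
    radius z < r k -> `|bump p z - bump p w| <= e.
  move=> tzw zk; have tz0 : tent p.1 (radius z) <= 0.
    rewrite leNgt; apply/negP => /(tent_supp (radius_ge0 z)).
    by rewrite ek /= leNgt zk.
  exact: ler_dist_between tzw tz0 (bump_ge0 p z) (bump_le_tent p z)
           (bump_ge0 p w) (bump_le_tent p w).
have [xk|xk] := ltP (radius x) (r k); first exact: low.
have [yk|yk] := ltP (radius y) (r k); first by rewrite distrC; apply: low => //; rewrite distrC.
by apply: hn; apply: (h2 k).
Qed.

Lemma dist_radius (x y : X) s : 0 <= s -> d x y < s -> `|radius x - radius y| < s.
Proof.
move=> s0; rewrite {1}(directionE x) {1}(directionE y) polar_dist_lt ?radius_ge0 // => h.
rewrite -ltr_cosh // cosh_abs (le_lt_trans _ h) // lerDl divr_ge0 // mulr_ge0 ?sqdist_ge0 //.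
by rewrite mulr_ge0 // sinh_ge0 // radius_ge0.
Qed.

(** The law of cosines bounds [sinh (r k)] times the chord by a constant depending on [s]; the mesh
    bound turns this into a decay like [expR (- D k)]. *)
Lemma dist_direction (x y : X) s k : 0 <= s -> d x y < s ->
  r k <= radius x -> r k <= radius y ->
  (N k.+1)%:R * `|sval (direction x) - sval (direction y)|
    <= C * expR (- D k) * Num.sqrt (2 * (cosh s - 1)).
Proof.
move=> s0; rewrite {1}(directionE x) {1}(directionE y) polar_dist_lt ?radius_ge0 // => h xk yk.
set u := direction x in h *; set v := direction y in h *.
have sk := sinh_gt0 (r_gt0 k).
have q0 := sqdist_ge0 u v.
have h1 : sinh (r k) ^+ 2 * sqdist u v <= 2 * (cosh s - 1).
  apply: le_trans (le_gap h (cosh_ge1 _)).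
  rewrite ler_wpM2r // expr2; apply: ler_pM; rewrite ?(ltW sk) //; exact: ler_sinh.
have h2 : sinh (r k) * `|sval u - sval v| <= Num.sqrt (2 * (cosh s - 1)).
  rewrite (le_trans (ler_wpM2l (ltW sk) (norm_le_dot _))) //.
  rewrite -[X in X * _](ger0_norm (ltW sk)) -sqrtr_sqr -sqrtrM ?sqr_ge0 // ler_sqrt //.
  by rewrite mulr_ge0 // subr_ge0 cosh_ge1.
rewrite (le_trans (ler_wpM2r (normr_ge0 _) (mesh_le k))) // -(mulrA (C * expR (- D k)) (sinh (r k))) ler_wpM2l //.
by rewrite mulr_ge0 ?expR_ge0 // ltW.
Qed.

Variables (L : eqType) (l : nat * Z -> L).

Let values b x := [set y : R | y = 0 \/ exists2 p, l p = b & y = bump p x]%classic.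

(** A supremum inherits the common modulus of continuity of the bumps, however many vertices share
    the label. The value 0 adjoined in [values] covers labels without vertices. *)
Definition label_bump b x : R := sup (values b x).

Let values_has_sup b x : has_sup (values b x).
Proof.
split; first by exists 0; left.
exists 1 => y [->//|[p _ ->]]; exact: le_trans (bump_le_tent _ _) (tent_le1 _ _).
Qed.

Lemma label_bump_ge p x : bump p x <= label_bump (l p) x.
Proof. by apply: ub_le_sup; [case: (values_has_sup (l p) x)|right; exists p]. Qed.

Lemma label_bump_ge0 b x : 0 <= label_bump b x.
Proof. by apply: ub_le_sup; [case: (values_has_sup b x)|left]. Qed.

Lemma label_bump_le1 b x : label_bump b x <= 1.
Proof.
apply: ge_sup; first by case: (values_has_sup b x).
by move=> y [->//|[p _ ->]]; exact: le_trans (bump_le_tent _ _) (tent_le1 _ _).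
Qed.

Lemma label_bump_gt0 b x : 0 < label_bump b x -> exists2 p, l p = b & 0 < bump p x.
Proof.
move=> h; apply: contrapT => nex; move: h; apply/negP; rewrite -leNgt.
apply: ge_sup; first by case: (values_has_sup b x).
move=> y [->//|[p lp ->]]; rewrite leNgt; apply/negP => h; apply: nex; by exists p.
Qed.

Lemma label_bump_dist b x y e : 0 <= e ->
  (forall p, `|bump p x - bump p y| <= e) -> `|label_bump b x - label_bump b y| <= e.
Proof.
move=> e0 h.
have half z w : (forall p, `|bump p z - bump p w| <= e) ->
    label_bump b z <= label_bump b w + e.
  move=> hp; apply: ge_sup; first by case: (values_has_sup b z).
  move=> v [->|[p <- ->]]; first by rewrite addr_ge0 // label_bump_ge0.
  by rewrite (le_trans (ler_distlDr (hp p))) // lerD2r label_bump_ge.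
have h1 := half x y h; have h2 : label_bump b y <= label_bump b x + e.
  by apply: half => p; rewrite distrC.
exact: ler_dist_sym h1 h2.
Qed.

Lemma label_bump_higson b : higson_function d (hyp_origin R n) (label_bump b).
Proof.
split; [|split].
- by exists 1 => x; rewrite ger0_norm ?label_bump_ge0 // label_bump_le1.
- move=> x e e0.
  have e20 : 0 < e / 2 by rewrite divr_gt0.
  (* Chosen so that [C * Num.sqrt (2 * (cosh s - 1)) = e / 2] at [cosh s = 1 + eta]. *)
  pose eta := (e / 2 / C) ^+ 2 / 2.
  have eta0 : 0 < eta by rewrite divr_gt0 // exprn_gt0 // divr_gt0.
  have c1 : 1 <= 1 + eta by lra.
  have s0 : 0 < arcosh (1 + eta).
    rewrite lt_neqAle arcosh_ge0 // andbT; apply/eqP => z0.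
    by have := cosh_arcosh c1; rewrite -z0 cosh0; lra.
  exists (Num.min (arcosh (1 + eta)) (e / 2 * D 0%N)).
    by rewrite lt_min s0 mulr_gt0.
  move=> y; rewrite lt_min => /andP[xy1 xy2].
  apply: (@le_lt_trans _ _ (e / 2)); last by lra.
  apply: label_bump_dist => [|p]; first exact: ltW.
  apply: bump_dist; first exact: ltW.
    have eD0 := mulr_ge0 (ltW e20) (ltW (D_gt0 0)).
    rewrite ler_pdivrMr // (le_trans (ltW (dist_radius eD0 xy2))) //.
    by rewrite ler_wpM2l ?(ltW e20) // D_mono.
  move=> k -> xk yk; apply: (le_trans (dist_direction (ltW s0) xy1 xk yk)).
  rewrite cosh_arcosh // /eta.
  rewrite [1 + _]addrC addrK [2 * _]mulrC divfK //.
  rewrite sqrtr_sqr ger0_norm; last by rewrite divr_ge0 // ltW.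
  have -> : C * expR (- D k) * (e / 2 / C) = expR (- D k) * (e / 2).
    by field; rewrite gt_eqF.
  by rewrite ler_piMl ?(ltW e20) // expR_le1 oppr_le0 ltW.
- move=> s s0 e e0.
  have e20 : 0 < e / 2 by rewrite divr_gt0.
  pose M := Num.sqrt (2 * (cosh s - 1)).
  have M0 : 0 <= M by exact: sqrtr_ge0.
  (* The two summands make the radial and the angular variation at most [e / 2] on high levels;
     bumps of low levels vanish far out. *)
  have [k0 hk0] := D_unbounded (s / (e / 2) + C * M / (e / 2)).
  have sM0 : 0 <= s / (e / 2) by rewrite divr_ge0 // ltW.
  have CM0 : 0 <= C * M / (e / 2) by rewrite divr_ge0 ?mulr_ge0 // ltW.
  exists (r k0.+2 + s) => x; rewrite hyp_dist_origin => xr.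
  suff h y : d x y < s -> `|label_bump b x - label_bump b y| <= e / 2.
    by move=> y z xy xz; exact: ler_dist_half (h y xy) (h z xz).
  move=> xy; apply: label_bump_dist => [|p]; first exact: ltW.
  have rxy := dist_radius (ltW s0) xy.
  have yr : r k0.+2 < radius y.
    by move: rxy; rewrite ltr_norml => /andP[? ?]; lra.
  have [pk|kp] := leqP p.1 k0.+1.
    have z w : r k0.+2 < radius w -> bump p w = 0.
      move=> wr; apply/le_anti; rewrite bump_ge0 andbT leNgt; apply/negP.
      move=> /bump_supp[_ /andP[_]]; rewrite leNgt => /negP; apply.
      by rewrite (le_lt_trans _ wr) // r_mono.
    by rewrite !z ?subrr ?normr0 ?(ltW e20) //; lra.
  apply: bump_dist; first exact: ltW.
    have Dk : s / (e / 2) + C * M / (e / 2) <= D p.1.-1.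
      by apply: hk0; move: kp; case: (p.1) => // j; exact: ltnW.
    rewrite ler_pdivrMr // (le_trans (ltW rxy)) // [leRHS]mulrC -ler_pdivrMr //.
    by apply: le_trans Dk; rewrite lerDl.
  move=> k ek xk yk; rewrite ek; apply: (le_trans (dist_direction (ltW s0) xy xk yk)).
  rewrite -/M.
  have Dk : s / (e / 2) + C * M / (e / 2) <= D k.
    by apply: hk0; move: kp; rewrite ek; exact: ltnW.
  rewrite expRN mulrAC ler_pdivrMr ?expR_gt0 // [leRHS]mulrC -ler_pdivrMr //.
  have DE : D k <= expR (D k) by apply: le_trans (expR_ge1Dx _); rewrite lerDr ler01.
  by apply: le_trans DE; apply: le_trans Dk; rewrite lerDr.
Qed.

Lemma bump_levels x : exists j, forall p, 0 < bump p x -> p.1 = j \/ p.1 = j.+1.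
Proof.
have [j [h1 h2]] := level_of (radius_ge0 x).
exists j => -[k a] h /=.
have : 0 < tent k (radius x) by apply: lt_le_trans (bump_le_tent (k, a) x).
rewrite /tent lt_max ltxx /= lt_min => /andP[t1 t2].
have kj : (j <= k)%N.
  case: h2 => [->//|h2]; rewrite -ltnS; apply: r_lt; apply: (le_lt_trans h2).
  have : (radius x - r k) / D k < 1 by lra.
  by rewrite ltr_pdivrMr // rS; lra.
suff : (k <= j.+1)%N by lia.
case: k t1 {a h t2 kj} => // k; rewrite rS => t1.
rewrite ltnS -ltnS; apply: r_lt; apply: (lt_trans _ h1).
have : - 1 < (radius x - (r k + D k)) / D k by lra.
by rewrite ltr_pdivlMr //; lra.
Qed.

End Bumps.

(** * The Higson compactification *)

Section HigsonCorona.
Local Open Scope classical_set_scope.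
Local Open Scope ring_scope.

(** A bound [M] of [f] on [X] gives [M + 1] on the closure, where points are approximated within 1;
    Tychonoff then applies. *)
Lemma higson_compactification_compact (R : realType) (X : Type) (d : X -> X -> R) (o : X) :
  compact (higson_compactification d o).
Proof.
apply: ptws_compact; first exact: closed_closure.
move=> f; have [M hM] := (proj2_sig f).1; exists (M + 1) => p Ap.
have [_ [[x _ <-] hx]] := Ap _ (ptws_ball_nbhs [:: f] p ltr01).
have := hx f (or_introl erefl); have := hM x; rewrite /higson_eval -/(sval f x) => h1 h2.
have := ler_normD (p f - sval f x) (sval f x); rewrite subrK => h3.
by rewrite (le_trans h3) // addrC lerD // ltW.
Qed.

(** * Centres of the cells of the net *)

Section Net.
Variables (R : realType) (n : nat).
Notation X := (hyp_space R n).
Notation d := (@hyp_dist R n).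
Notation o := (hyp_origin R n).
Notation Z := {ffun 'I_n -> int}.

Variables (fs : seq (higson_index d o)) (e : R).

Definition oscillation_le (s t : R) := forall x y : X, s <= radius x -> d x y < t ->
  forall f, List.In f fs -> `|sval f x - sval f y| <= e.

Lemma oscillation_le_mono s s' t t' : s <= s' -> t' <= t ->
  oscillation_le s t -> oscillation_le s' t'.
Proof.
by move=> ss tt h x y sx xy; apply: h; [exact: le_trans sx|exact: lt_le_trans tt].
Qed.

Lemma oscillation_bounds : (0 < n)%N -> 0 < e ->
  (exists2 t, 0 < t & oscillation_le 0 t) /\ (forall t, exists s, oscillation_le s t).
Proof.
move=> n0 e0; rewrite /oscillation_le; elim: fs => [|f gs [[t t0 ht] hfar]].
  by split; [exists 1 => // ? ? ? ? ? []|move=> t; exists 0 => ? ? ? ? ? []].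
have [[t' t'0 ht'] hfar'] := higson_oscillation n0 (proj2_sig f) e0.
split.
  exists (Num.min t t'); first by rewrite lt_min t0.
  move=> x y x0; rewrite lt_min => /andP[xt xt'] g [<-|]; first exact: ht'.
  exact: ht.
move=> s; have [r hr] := hfar s; have [r' hr'] := hfar' s.
exists (Num.max r r') => x y; rewrite ge_max => /andP[rx rx'] xy g [<-|]; first exact: hr'.
exact: hr.
Qed.

Variables (r : nat -> R) (N : nat -> nat).
Hypothesis r_ge0 : forall k, 0 <= r k.
Hypothesis scale : forall k t q, inner r k <= t -> t <= r k.+1 -> 0 <= q -> q <= 4 ->
  (N k)%:R ^+ 2 * q <= 16 * n%:R ->
  exists2 s, 0 <= s & oscillation_le (inner r k) s /\
    cosh (t - r k) + sinh t * sinh (r k) * q / 2 < cosh s.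

Lemma sqdist_le4 (u v : unit_vec R n) : sqdist u v <= 4.
Proof.
have e1 : dot (sval u + sval v) (sval u + sval v) = 2 + 2 * dot (sval u) (sval v).
  rewrite dotDl (dotC (sval u)) (dotC (sval v) (_ + _)) !dotDl (dotC (sval v) (sval u)).
  by rewrite (proj2_sig u) (proj2_sig v); ring.
have := dot_ge0 (sval u + sval v); rewrite e1 /sqdist dotB2.
by rewrite (proj2_sig u) (proj2_sig v); move: (dot _ _) => y; lra.
Qed.

Lemma lattice_near_sqdist k a (u v : unit_vec R n) :
  lattice_near N k (sval u) a -> lattice_near N k (sval v) a ->
  (N k)%:R ^+ 2 * sqdist u v <= 16 * n%:R.
Proof.
move=> hu hv.
have -> : (N k)%:R ^+ 2 * sqdist u v =
    dot ((N k)%:R *: (sval u - sval v)) ((N k)%:R *: (sval u - sval v)).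
  by rewrite dotZl dotC dotZl mulrA expr2.
have -> : 16 * n%:R = n%:R * 4 ^+ 2 :> R by rewrite mulrC; congr (_ * _); ring.
apply: dot_le_coord => j; rewrite !mxE.
have := hu j; have := hv j; rewrite !ler_norml.
by move=> /andP[? ?] /andP[? ?]; apply/andP; split; lra.
Qed.

(** The centre is [polar (r k) v] for any direction [v] near [a]; every point of the cell is then
    within the distance at which the functions of [fs] oscillate by at most [e]. Empty cells get the
    origin. *)
Lemma centers_exist : exists ctr : nat * Z -> X,
  forall k a (u : unit_vec R n) t, lattice_near N k (sval u) a ->
    inner r k <= t -> t <= r k.+1 ->
    forall f, List.In f fs -> `|sval f (polar t u) - sval f (ctr (k, a))| <= e.
Proof.
have h p : exists x : X, forall (u : unit_vec R n) t, lattice_near N p.1 (sval u) p.2 ->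
    inner r p.1 <= t -> t <= r p.1.+1 ->
    forall f, List.In f fs -> `|sval f (polar t u) - sval f x| <= e.
  case: p => k a /=.
  have [[v hv]|no] := pselect (exists v : unit_vec R n, lattice_near N k (sval v) a); last first.
    by exists o => u t hu; case: no; exists u.
  exists (polar (r k) v) => u t hu lo hi.
  have [s s0 [os cs]] := scale lo hi (sqdist_ge0 u v) (sqdist_le4 u v)
    (lattice_near_sqdist hu hv).
  have t0 : 0 <= t by apply: le_trans lo; case: (k).
  apply: os; first by rewrite radius_polar.
  by rewrite polar_dist_lt.
exists (fun p => sval (cid (h p))) => k a u t hu lo hi f ff.
exact: (svalP (cid (h (k, a))) u t hu lo hi f ff).
Qed.

End Net.

Lemma cech_higson_hyp_vanishes (R : realType) (n q : nat) : (0 < n)%N -> odd q ->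
  cech_H_vanishes (higson_compactification (@hyp_dist R n) (hyp_origin R n)) q.
Proof.
move=> n0 oq I U cU c hc.
set d := @hyp_dist R n; set o := hyp_origin R n.
have [fs [e [m [iota [e0 hleb]]]]] :=
  ptws_lebesgue (@higson_compactification_compact R _ d o) cU.
have Aev x : higson_compactification d o (higson_eval d o x).
  by apply: subset_closure; exists x.
pose lamX x := sval (cid (hleb _ (Aev x))).
have hlamX x : ptws_ball fs e (higson_eval d o x) `<=` U (iota (lamX x)).
  exact: svalP (cid (hleb _ (Aev x))).
(* The approximation of a point of the compactification and the oscillation over a cell each cost a
   quarter of the Lebesgue number. *)
have e40 : 0 < e / 4 by rewrite divr_gt0.
have [[t t0 ht] hfar] := oscillation_bounds fs n0 e40.
pose D0 := t / 25.
have D00 : 0 < D0 by rewrite divr_gt0.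
have tE : 25 * D0 = t by rewrite /D0 mulrC divfK.
have osc0 : oscillation_le fs (e / 4) 0 (25 * D0) by rewrite tE.
have [r [D [[r0 Dz rS Dstep] [oscr Dunb]]]] :=
  gaps_exist (@oscillation_le_mono R n fs (e / 4)) hfar D00 osc0.
have [N [[[C C0 mesh] N0 Ngt0 Nstep] [Nbig scale]]] :=
  mesh_exists n D00 osc0 r0 Dz rS Dstep oscr Dunb.
have Dmono : {homo D : i j / (i <= j)%N >-> i <= j}.
  by apply: homo_leq => // [i j k|k]; [exact: le_trans|case/andP: (Dstep k)].
have Dgt0 k : 0 < D k by apply: lt_le_trans (Dmono 0%N k isT); rewrite Dz.
have rgt0 k : 0 < r k.
  by elim: k => [|k IH]; [rewrite r0|rewrite rS addr_gt0].
have [ctr hctr] := centers_exist (fun k => ltW (rgt0 k)) scale.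
pose lam p := lamX (ctr p).
pose S := fun u : 'rV[R]_n => dot u u = 1.
pose near k (u : unit_vec R n) := lattice_near N k (sval u).
pose x0 := lamX o.
pose cl := list_cochain x0 (fun s : 'I_q.+2 -> 'I_m => c (iota \o s)).
(* The one point [polar (r j) u] lies in the cover members of all these vertices, so they span a
   simplex of the nerve, where [c] is closed. *)
have near_center j u p : near_pair near j u p ->
    U (iota (lam p)) (higson_eval d o (polar (r j) u)).
  case: p => k a [/= hk ha]; apply: hlamX => f ff.
  rewrite distrC; apply: le_lt_trans (hctr k a u (r j) ha _ _ f ff) _.
  - by case: hk => ->; rewrite /= ?lexx //; case: (j) => [|i]; rewrite /= ?rS ?lerDl ltW.
  - by case: hk => ->; rewrite !rS ?lerDl -?addrA ?lerDl ?addr_ge0 ?ltW.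
  - lra.
have hcl j (u : unit_vec R n) s : (forall p, p \in s -> near_pair near j u p) ->
    list_delta cl (map lam s) = 0.
  move=> hs; rewrite /cl list_delta_cochain; case: ifP => // /eqP sq.
  rewrite -[LHS]/(cech_delta c (fun i => iota (nth x0 (map lam s) i))); apply: hc.
  exists (higson_eval d o (polar (r j) u)); first exact: Aev.
  move=> k; have ks : (k < size s)%N by rewrite -(size_map lam) sq ltn_ord.
  rewrite (nth_map (0%N, [ffun=> 0])) //; apply: near_center.
  by apply: hs; rewrite mem_nth.
have cl0 s : size s != q.+2 -> cl s = 0 by rewrite /cl /list_cochain => /negbTE ->.
(* The primitive lives on lists of [q.+1] vertices, and it is this length that must be even. *)
have qe : ~~ odd q.+1 by rewrite /= negbK.
have [L [l [lam' [b [hlam' hb]]]]] :=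
  @labelled_primitive R n N S q.+1 m lam cl N0 Ngt0 Nstep Nbig qe isT cl0 hcl.
pose Phi b : higson_index d o :=
  exist _ _ (label_bump_higson n0 (rgt0 0%N) rS Dgt0 Dmono Dunb C0 mesh N0 l b).
(* With approximation within 1/8, a bump of at least 1/2 forces a value above 1/4, and a value above
   1/4 forces a positive bump. *)
pose V b := [set p : {ptws (higson_index d o) -> R} | 1 / 4 < p (Phi b)].
have approx p : higson_compactification d o p -> exists x,
    (forall f, List.In f fs -> `|p f - sval f x| < e / 4) /\
    (forall b, `|p (Phi b) - sval (Phi b) x| < 1 / 8).
  (* Finitely many labels allow one point [x] to approximate [p] on all label bumps and on [fs] at
     once. *)
  move=> Ap; pose gs := fs ++ map Phi (enum L).
  have e80 : 0 < Num.min (e / 4) (1 / 8) by rewrite lt_min e40 divr_gt0.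
  have [_ [[x _ <-] hx]] := Ap _ (ptws_ball_nbhs gs p e80).
  exists x; split=> [f ff|b'].
    have := hx f (List.in_or_app _ _ _ (or_introl ff)).
    by rewrite lt_min => /andP[].
  have : List.In (Phi b') (map Phi (enum L)).
    apply: List.in_map; have := mem_enum L b'; rewrite inE.
    by elim: (enum L) => //= y ys IH; rewrite inE => /orP[/eqP->|/IH]; [left|right].
  move=> /(fun h => hx _ (List.in_or_app _ _ _ (or_intror h))).
  by rewrite lt_min => /andP[].
have pos p x b' : `|p (Phi b') - sval (Phi b') x| < 1 / 8 -> V b' p ->
    exists2 v, l v = b' & 0 < bump r D N n0 v x.
  rewrite /V /= ltr_norml => /andP[_ h1] h2; apply: (label_bump_gt0 Dgt0).
  by move: h1 h2; rewrite /=; move: (label_bump _ _ _ _ _ _ _) (p _) => y z; lra.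
exists L, V, (iota \o lam'); split.
- split=> [b'|p Ap].
    rewrite /V (_ : [set p | _] = (fun p : {ptws (higson_index d o) -> R} => p (Phi b'))
      @^-1` [set y | 1 / 4 < y]) //.
    apply: open_comp; last exact: open_gt.
    by move=> p _; apply: ptws_eval_continuous.
  have [x [_ hx]] := approx p Ap.
  have [v hv] := bump_cover N n0 (rgt0 0%N) rS Dgt0 Dunb x.
  exists (l v) => //; rewrite /V /=.
  have := label_bump_ge r N n0 Dgt0 l v x; have := hx (l v).
  rewrite ltr_norml /= => /andP[h1 _].
  move: h1 hv; move: (label_bump _ _ _ _ _ _ _) (p _) (bump _ _ _ _ _ _) => y z w; lra.
- move=> b' p [Ap Vp]; have [x [hf hx]] := approx p Ap.
  have [[k a] lv bv] := pos p x b' (hx b') Vp.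
  have [hn /andP[lo hi]] := bump_supp rS Dgt0 bv.
  rewrite /= -lv hlam'; apply: hlamX => f ff.
  have h1 := hf f ff; have h2 := hctr k a (direction n0 x) (radius x) hn lo hi f ff.
  rewrite -directionE in h2; rewrite /higson_eval distrC.
  rewrite -(subrKA (sval f x)) (le_lt_trans (ler_normD _ _)) //.
  by apply: lt_le_trans (ltr_leD h1 h2) _; lra.
- exists (fun s => b (codom s)) => s [p Ap hp]; have [x [_ hx]] := approx p Ap.
  (* The vertices chosen here have positive bumps at the same [x], so they are near its direction
     and lie on two consecutive levels. *)
  have /choice[v hv] : forall i, exists v, l v = s i /\ 0 < bump r D N n0 v x.
    by move=> i; have [v ? ?] := pos p x (s i) (hx (s i)) (hp i); exists v.
  have [j hj] := bump_levels n0 (rgt0 0%N) rS Dgt0 Dunb C0 N0 x.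
  rewrite (cech_delta_codom b s).
  have cs : codom s = map l (codom v).
    by rewrite -map_comp; apply: eq_map => i /=; case: (hv i).
  rewrite cs (hb j (direction n0 x)).
  - rewrite -(list_cochain_codom x0 (fun s : 'I_q.+2 -> 'I_m => c (iota \o s)) (lam' \o s)).
    congr list_cochain; rewrite -map_comp; apply: eq_map => i /=.
    by have [<- _] := hv i; rewrite hlam'.
  - move=> w /codomP[i ->]; have [_ h] := hv i.
    by split; [exact: hj|case: (bump_supp rS Dgt0 h)].
  - by rewrite size_codom card_ord.
Qed.

End HigsonCorona.

Unset Implicit Arguments.

(* For n >= 1 and k >= 1: reduced Cech H^{2k}(Higson compactification of H^n; Z) = 0.
   cech_H_vanishes A q means H^{q+1}(A;Z)=0; here q+1 = 2k >= 2, where reduced = unreduced cohomology. *)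
Theorem theorem6p8 (R : realType) (n k : nat) (hn : (1 <= n)%N) (hk : (1 <= k)%N) :
  cech_H_vanishes
    (higson_compactification (@hyp_dist R n)
       (hyp_origin R n))
    (2 * k).-1.
Proof.
apply: cech_higson_hyp_vanishes => //.
by case: k hk => // k _; rewrite mul2n doubleS /= odd_double.
Qed.
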